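(* Let $N\geq 2$, $p>1$ and let $\Omega\subset\mathbb{R}^N$ be a bounded and smooth domain. Then the limit $\mu(\Omega):=\lim_{q\to 0^+}\lambda_q(\Omega)\,|\Omega|^{p/q}$ exists and satisfies $$0<\mu(\Omega)<\infty .$$
   Context: $|\Omega|$ denotes the $N$-dimensional Lebesgue measure of $\Omega$, and $\|\cdot\|_p$ the norm of $L^p(\Omega)$. For $q\in(0,1)$, $$\lambda_q(\Omega):=\inf\left\{\|\nabla v\|_p^p : v\in W_0^{1,p}(\Omega)\ \text{and}\ \int_\Omega |v|^q\,dx=1\right\}.$$ *)

(* Defs.v *)
From HB Require Import structures.
From mathcomp Require Import all_boot all_order all_algebra.
From mathcomp Require Import all_classical all_reals all_analysis.

Set Implicit Arguments.
Unset Strict Implicit.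
Unset Printing Implicit Defensive.
Import Order.TTheory GRing.Theory Num.Theory.
Import numFieldNormedType.Exports.
Local Open Scope classical_set_scope.
Local Open Scope ring_scope.

(* R^N is 'rV[R]_N; it carries the sigma-algebra generated by the coordinate
   functions, which for R^N is the Borel one. *)
Definition measure_rV_display : measure_display -> measure_display.
Proof. exact. Qed.

Section measurable_rV.
Context {d} {T : measurableType d}.
Variable n : nat.

Let coors : 'I_n -> 'rV[T]_n -> T := fun i x => x ord0 i.

Let rV_set0 : g_sigma_preimage coors set0.
Proof. exact: sigma_algebra0. Qed.

Let rV_setC A : g_sigma_preimage coors A -> g_sigma_preimage coors (~` A).
Proof. exact: sigma_algebraC. Qed.

Let rV_bigcup (F : _^nat) : (forall i, g_sigma_preimage coors (F i)) ->
  g_sigma_preimage coors (\bigcup_i (F i)).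
Proof. exact: sigma_algebra_bigcup. Qed.

HB.instance Definition _ := @isMeasurable.Build (measure_rV_display d)
  'rV[T]_n (g_sigma_preimage coors) rV_set0 rV_setC rV_bigcup.

Lemma measurable_coord (i : 'I_n) :
  measurable_fun [set: 'rV[T]_n] (fun x : 'rV[T]_n => x ord0 i).
Proof.
move=> _ Y mY; rewrite setTI; apply: sub_sigma_algebra => /=.
rewrite -bigcup_seq/=; exists i => /=; first by rewrite mem_index_enum.
by exists Y => //; rewrite setTI.
Qed.

Lemma measurable_fun_rVP d' (S : measurableType d') (f : S -> 'rV[T]_n) :
  (forall i, measurable_fun [set: S] (fun x => f x ord0 i)) ->
  measurable_fun [set: S] f.
Proof.
move=> mf _ A mA; rewrite setTI.
pose G := [set A : set 'rV[T]_n | measurable (f @^-1` A)].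
suff : g_sigma_preimage coors `<=` G by apply.
apply: smallest_sub.
  split => /=.
  - by rewrite /G /= preimage_set0; exact: measurable0.
  - by move=> B mB; rewrite /G /= setTD preimage_setC; apply: measurableC mB.
  - by move=> F mF; rewrite /G /= preimage_bigcup; apply: bigcup_measurable => k _; exact: mF.
move=> B; rewrite -bigcup_seq => -[i _ [C mC <-]] /=.
by have := mf i measurableT C mC; rewrite !setTI.
Qed.

End measurable_rV.

Section rV_cons.
Context {d} {T : measurableType d}.

Definition rV_cons n (u : T * 'rV[T]_n) : 'rV[T]_n.+1 :=
  \row_i (if unlift ord0 i is Some j then u.2 ord0 j else u.1).

Definition rV_uncons n (x : 'rV[T]_n.+1) : T * 'rV[T]_n :=
  (x ord0 ord0, \row_j x ord0 (lift ord0 j)).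

Lemma rV_consK n : cancel (@rV_cons n) (@rV_uncons n).
Proof.
move=> [x y]; rewrite /rV_uncons mxE unlift_none /=; congr pair.
by apply/rowP => j; rewrite !mxE liftK /= ord1.
Qed.

Lemma measurable_rV_cons n : measurable_fun [set: T * 'rV[T]_n] (@rV_cons n).
Proof.
apply: measurable_fun_rVP => i.
under eq_fun do rewrite mxE.
case: unlift => [j|]; last exact: measurable_fst.
exact: (measurableT_comp (measurable_coord j) measurable_snd).
Qed.

Lemma measurable_rV_uncons n : measurable_fun [set: 'rV[T]_n.+1] (@rV_uncons n).
Proof.
apply: measurable_fun_pair; first exact: measurable_coord.
apply: measurable_fun_rVP => i.
under eq_fun do rewrite mxE.
exact: measurable_coord.
Qed.

End rV_cons.

Section product_rV.
Context {d} {T : measurableType d} {R : realType}.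
Local Open Scope ereal_scope.
Variables (m1 : {sigma_finite_measure set T -> \bar R}) (n : nat).
Variable m2 : {sigma_finite_measure set 'rV[T]_n -> \bar R}.

Definition product_rV : set 'rV[T]_n.+1 -> \bar R :=
  pushforward (m1 \x m2) (@rV_cons _ T n).

(* The canonical instance for products of sigma-finite measures is masked by
   the one for products of probabilities. *)
Let product_measure_sigma_finite : sigma_finite setT (m1 \x m2).
Proof.
have /sigma_finiteP[F [TF ndF Foo]] := sigma_finiteT m1.
have /sigma_finiteP[G [TG ndG Goo]] := sigma_finiteT m2.
exists (fun k => F k `*` G k).
  rewrite -setXTT TF TG predeqE => -[x y]; split.
    move=> [/= [k _ Fkx] [l _ Gly]]; exists (maxn k l) => //; split.
    - by move: x Fkx; exact/subsetPset/ndF/leq_maxl.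
    - by move: y Gly; exact/subsetPset/ndG/leq_maxr.
  by move=> [k _ []/= ? ?]; split; exists k.
move=> k; have [? ?] := Foo k; have [? ?] := Goo k.
split; first exact: measurableX.
by rewrite product_measure1E// lte_mul_pinfty// ge0_fin_numE.
Qed.

Let step0 : product_rV set0 = 0.
Proof. by rewrite /product_rV /pushforward preimage_set0 measure0. Qed.

Let step_ge0 A : 0 <= product_rV A.
Proof. by rewrite /product_rV /pushforward; exact: measure_ge0. Qed.

Let step_sigma_additive : semi_sigma_additive product_rV.
Proof.
exact: (@measure_semi_sigma_additive _ _ _
  (measure_function_pushforward__canonical__measure_function_Measure
    (m1 \x m2) (@measurable_rV_cons _ T n))).
Qed.

HB.instance Definition _ := isMeasure.Build _ _ _ product_rV
  step0 step_ge0 step_sigma_additive.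

Let step_sigma_finite : sigma_finite setT product_rV.
Proof.
have [F FT Ffin] := product_measure_sigma_finite.
exists (fun i => @rV_uncons _ _ n @^-1` F i).
  by rewrite -preimage_bigcup -FT preimage_setT.
move=> i; have [mFi Fi] := Ffin i; split.
  rewrite -[X in measurable X]setTI.
  exact: measurable_rV_uncons.
rewrite /product_rV /pushforward -comp_preimage.
rewrite (_ : _ \o _ = id) ?preimage_id//.
by apply/funext => u /=; rewrite rV_consK.
Qed.

HB.instance Definition _ :=
  Measure_isSigmaFinite.Build _ _ _ product_rV step_sigma_finite.

End product_rV.

Section lebesgue_rV.
Context {R : realType}.
Local Open Scope ereal_scope.

(* lebesgue_measure lives on measurableTypeR R, whose display differs from that
   of the canonical measurable structure of R. *)
Definition lebesgue_R : set R -> \bar R := lebesgue_measure.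

HB.instance Definition _ := isMeasure.Build _ R R lebesgue_R
  (measure0 (@lebesgue_measure R)) (measure_ge0 (@lebesgue_measure R))
  (measure_semi_sigma_additive (s := @lebesgue_measure R)).

HB.instance Definition _ := Measure_isSigmaFinite.Build _ R R lebesgue_R
  (sigma_finiteT (@lebesgue_measure R)).

Fixpoint lebesgue_rV n : {sigma_finite_measure set 'rV[R]_n -> \bar R} :=
  if n is n'.+1 then product_rV lebesgue_R (lebesgue_rV n')
  else @dirac _ 'rV[R]_0 0%R R.

(* Normalisation: boxes have the product of their side lengths as measure. *)
Lemma lebesgue_rV_box n (A : 'I_n -> set R) :
  (forall i, measurable (A i)) ->
  lebesgue_rV n [set x | forall i, A i (x ord0 i)] =
  \prod_(i < n) lebesgue_measure (A i).
Proof.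
elim: n A => [|n IHn] A mA.
  rewrite big_ord0 /= diracE mem_set//= => i.
  by case: i.
pose B := [set y : 'rV[R]_n | forall i, A (lift ord0 i) (y ord0 i)].
rewrite big_ord_recl -IHn//.
have BE : B = \bigcap_(i in [set: 'I_n])
    (fun x : 'rV[R]_n => x ord0 i) @^-1` A (lift ord0 i).
  by apply/seteqP; split => x /= H i //=; exact: H.
have mB : measurable B.
  rewrite BE; apply: fin_bigcap_measurable => [|i _]; first exact: finite_finset.
  by rewrite -[X in measurable X]setTI; apply: measurable_coord.
transitivity ((lebesgue_R \x lebesgue_rV n) (A ord0 `*` B)); last first.
  exact: product_measure1E.
rewrite /= /product_rV /pushforward; congr product_measure1.
apply/seteqP; split => [[u y]|[u y] [/= Au Ay]].
  move=> /= H; split => [|i] /=.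
    by have := H ord0; rewrite mxE unlift_none.
  by have := H (lift ord0 i); rewrite mxE liftK.
by move=> i; rewrite /= mxE; case: unliftP => [j ->|->].
Qed.

End lebesgue_rV.

Section smooth.
Context {R : realType}.

Definition partial n (i : 'I_n) (f : 'rV[R]_n -> R) : 'rV[R]_n -> R :=
  fun x => 'D_(delta_mx ord0 i) f x.

Fixpoint Ck n (k : nat) (f : 'rV[R]_n -> R) : Prop :=
  continuous f /\
  if k is k'.+1 then
    forall i, (forall x, derivable f x (delta_mx ord0 i)) /\ Ck k' (partial i f)
  else True.

Definition smooth n (f : 'rV[R]_n -> R) := forall k, Ck k f.

(* Near each boundary point, and for some coordinate axis i with some
   orientation, Omega is the region on one side of the graph of a smooth
   function of the other N - 1 coordinates. *)
Definition smooth_boundary n (Omega : set 'rV[R]_n) :=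
  forall x0, (closure Omega `\` Omega°) x0 ->
  exists (i : 'I_n) (b : bool) (gamma : 'rV[R]_n.-1 -> R),
    smooth gamma /\
    \forall x \near x0,
      Omega x <-> 0 < (-1) ^+ b * (x ord0 i - gamma (col' i x)).

Definition bounded_smooth_domain n (Omega : set 'rV[R]_n) :=
  [/\ Omega !=set0, open Omega, connected Omega, bounded_set Omega &
      smooth_boundary Omega].

Definition test_function n (Omega : set 'rV[R]_n) (phi : 'rV[R]_n -> R) :=
  let supp := closure [set x | phi x != 0] in
  [/\ smooth phi, compact supp & supp `<=` Omega].

End smooth.

Section sobolev.
Context {R : realType} {n : nat}.
Variables (Omega : set 'rV[R]_n) (p : R).

Definition euclidean_norm (x : 'rV[R]_n) : R :=
  Num.sqrt (\sum_i x ord0 i ^+ 2).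

Definition Lp_norm (f : 'rV[R]_n -> R) : \bar R :=
  'N[lebesgue_rV n]_p%:E[EFin \o f \_ Omega].

Definition in_Lp (f : 'rV[R]_n -> R) :=
  measurable_fun Omega f /\ (Lp_norm f < +oo)%E.

Definition weak_gradient (v : 'rV[R]_n -> R) (g : 'rV[R]_n -> 'rV[R]_n) :=
  forall (i : 'I_n) phi, test_function Omega phi ->
  \int[lebesgue_rV n]_(x in Omega) (v x * partial i phi x) =
  - \int[lebesgue_rV n]_(x in Omega) (g x ord0 i * phi x).

(* v belongs to W^{1,p}(Omega), with weak gradient g. *)
Definition in_W1p (v : 'rV[R]_n -> R) (g : 'rV[R]_n -> 'rV[R]_n) :=
  [/\ in_Lp v, forall i, in_Lp (fun x => g x ord0 i) & weak_gradient v g].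

(* v, with weak gradient g, belongs to W_0^{1,p}(Omega), the closure of
   C_c^oo(Omega) in W^{1,p}(Omega). *)
Definition in_W01p (v : 'rV[R]_n -> R) (g : 'rV[R]_n -> 'rV[R]_n) :=
  in_W1p v g /\
  exists phi : nat -> 'rV[R]_n -> R,
    [/\ forall k, test_function Omega (phi k),
        Lp_norm (fun x => phi k x - v x) @[k --> \oo] --> 0%E &
        forall i, Lp_norm (fun x => partial i (phi k) x - g x ord0 i)
                    @[k --> \oo] --> 0%E].

Definition lambda (q : R) : \bar R :=
  ereal_inf [set t | exists v g,
    [/\ in_W01p v g,
        (\int[lebesgue_rV n]_(x in Omega) (`|v x| `^ q)%:E = 1)%E &
        t = (Lp_norm (fun x => euclidean_norm (g x)) `^ p)%E]].

End sobolev.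

(* Main.v *)
Require Import Defs.
From mathcomp Require Import all_boot all_order all_algebra.
From mathcomp Require Import all_classical all_reals all_analysis.
From mathcomp Require Import measurable_realfun ring lra.

Set Implicit Arguments.
Unset Strict Implicit.
Unset Printing Implicit Defensive.
Import Order.TTheory GRing.Theory Num.Theory.
Import numFieldNormedType.Exports.
Local Open Scope classical_set_scope.
Local Open Scope ring_scope.

(** For v in W_0^{1,p} let Q_q(v) be the quotient of int |grad v|^p by
    (mean of |v|^q)^(p/q), the mean being taken over Omega. Normalising v shows
    that lambda_q |Omega|^(p/q) is the infimum of Q_q. Power means increase
    with their exponent (integral_powR_mono), so this infimum is nonincreasing
    in q on ]0, p[ (lambda_quotient_mono), and its limit at 0+ exists in the
    extended reals: it is its supremum. It remains to bound it on both sides.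

    Lower bound (lambda_quotient_lb): the power mean of exponent q is at most
    that of exponent p, which the Poincare inequality controls by the gradient.
    On test functions Poincare's inequality reduces to dimension one along a
    coordinate axis; it passes to W_0^{1,p} by density.

    Upper bound (lambda_quotient_ub): competitors are needed whose gradients
    are bounded independently of q, while the mean of their q-th power is at
    least 1 - A q, because (1 - A q)^(-p/q) stays bounded. Near each point of
    the closure, Omega is the set where a smooth function rho, the signed height
    over a graph, is positive. With h(t) = exp(-1/sqrt t), smooth and flat at 0,
    and a bump function chi, the function chi h(rho - q^2) is a test function of
    Omega with gradient bounded independently of q. Since -ln h(rho) is of the
    order of rho^(-1/2), which is integrable across the graph, h(rho - q^2)^q
    differs from 1 by O(q) in the mean; the shift by q^2 is small enough not to
    spoil this (flat1_deficit). Finitely many such pieces cover the closure of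
    Omega, and their sum is the competitor. Smoothness of the boundary enters
    only through these charts. *)

(** * Integration along a coordinate axis *)

Section axis.
Variable R : realType.
Local Open Scope ereal_scope.

Definition rV_insert n (i : 'I_n.+1) (t : R) (y : 'rV[R]_n) : 'rV[R]_n.+1 :=
  \row_k (if unlift i k is Some l then y ord0 l else t).

Lemma rV_insert_id n (i : 'I_n.+1) t y : rV_insert i t y ord0 i = t.
Proof. by rewrite mxE unlift_none. Qed.

Lemma rV_insert_lift n (i : 'I_n.+1) t y j :
  rV_insert i t y ord0 (lift i j) = y ord0 j.
Proof. by rewrite mxE liftK. Qed.

Lemma col'_rV_insert n (i : 'I_n.+1) t (y : 'rV[R]_n) :
  col' i (rV_insert i t y) = y.
Proof. by apply/rowP => k; rewrite mxE rV_insert_lift. Qed.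

Lemma rV_insertDdelta n (i : 'I_n.+1) s t (y : 'rV[R]_n) :
  rV_insert i (s + t)%R y = (s *: delta_mx ord0 i + rV_insert i t y)%R.
Proof.
apply/rowP => k; case: (unliftP i k) => [l ->|->].
  rewrite [RHS]mxE !rV_insert_lift !mxE eqxx/= eq_sym (negbTE (neq_lift _ _)).
  by rewrite mulr0 add0r.
by rewrite [RHS]mxE !rV_insert_id !mxE !eqxx mulr1.
Qed.

(** Inserting along a later axis commutes with prepending the first
    coordinate; this is the induction step of tonelli_axis. *)
Lemma rV_cons_insert n (j : 'I_n.+1) s t (z : 'rV[R]_n) :
  rV_insert (lift ord0 j) t (rV_cons (s, z)) = rV_cons (s, rV_insert j t z).
Proof.
have cons0 m (y : 'rV[R]_m) : rV_cons (s, y) = rV_insert ord0 s y by [].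
apply/rowP => k; case: (unliftP (lift ord0 j) k) => [l ->|->].
  rewrite rV_insert_lift !cons0; case: (unliftP ord0 l) => [m ->|->].
    have -> : lift (lift ord0 j) (lift ord0 m) = lift ord0 (lift j m).
      by apply: val_inj; rewrite /= /bump /= !add1n ltnS addnS.
    by rewrite !rV_insert_lift.
  have -> : lift (lift ord0 j) ord0 = ord0 :> 'I_n.+2 by exact: val_inj.
  by rewrite !rV_insert_id.
by rewrite rV_insert_id cons0 rV_insert_lift rV_insert_id.
Qed.

Lemma measurable_rV_insert n (i : 'I_n.+1) :
  measurable_fun [set: R * 'rV[R]_n] (fun u => rV_insert i u.1 u.2).
Proof.
apply: measurable_fun_rVP => k.
under eq_fun do rewrite mxE.
case: unlift => [j|]; last exact: measurable_fst.
exact: (measurableT_comp (measurable_coord j) measurable_snd).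
Qed.

Lemma measurable_rV_insertl n (i : 'I_n.+1) (y : 'rV[R]_n) :
  measurable_fun [set: R] (fun t => rV_insert i t y).
Proof.
exact: (measurableT_comp (measurable_rV_insert i) (measurable_pair2 y)).
Qed.

Section nonneg.
Variables (n : nat) (F : 'rV[R]_n.+1 -> \bar R).
Hypothesis mF : measurable_fun setT F.
Hypothesis F0 : forall x, 0 <= F x.

Lemma measurable_line_integral (i : 'I_n.+1) :
  measurable_fun setT
    (fun y => \int[@lebesgue_R R]_t F (rV_insert i t y)).
Proof.
apply: (@measurable_fun_fubini_tonelli_G _ _ _ _ _ (@lebesgue_R R)
  (fun u => F (rV_insert i u.1 u.2))) => //.
exact: (measurableT_comp mF (measurable_rV_insert i)).
Qed.

Let consE :
  \int[lebesgue_rV n.+1]_x F x =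
  \int[@lebesgue_R R \x lebesgue_rV n]_u F (rV_cons u).
Proof.
rewrite (@ge0_integral_pushforward _ _ _ _ _ _ (@measurable_rV_cons _ R n)
  (@lebesgue_R R \x lebesgue_rV n) setT F measurableT mF) ?preimage_setT//.
Qed.

Lemma tonelli_cons1 : \int[lebesgue_rV n.+1]_x F x =
  \int[@lebesgue_R R]_s \int[lebesgue_rV n]_z F (rV_cons (s, z)).
Proof.
rewrite consE fubini_tonelli1//.
exact: (measurableT_comp mF (@measurable_rV_cons _ R n)).
Qed.

Lemma tonelli_cons2 : \int[lebesgue_rV n.+1]_x F x =
  \int[lebesgue_rV n]_z \int[@lebesgue_R R]_s F (rV_cons (s, z)).
Proof.
rewrite consE fubini_tonelli2//.
exact: (measurableT_comp mF (@measurable_rV_cons _ R n)).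
Qed.

End nonneg.

(** The measure on 'rV_n peels off the coordinates from the first one, so this
    is Tonelli's theorem for i = 0; the other axes follow by induction, the
    first coordinate being integrated last on both sides. *)
Lemma tonelli_axis n (F : 'rV[R]_n.+1 -> \bar R) (i : 'I_n.+1) :
  measurable_fun setT F -> (forall x, 0 <= F x) ->
  \int[lebesgue_rV n.+1]_x F x =
  \int[lebesgue_rV n]_y \int[@lebesgue_R R]_t F (rV_insert i t y).
Proof.
elim: n => [|n IHn] in F i *; move=> mF F0.
  by rewrite (ord1 i) tonelli_cons2.
case: (unliftP ord0 i) => [j ->|->]; last by rewrite tonelli_cons2.
have mG : measurable_fun setT (fun y =>
    \int[@lebesgue_R R]_t F (rV_insert (lift ord0 j) t y)).
  exact: measurable_line_integral.
rewrite tonelli_cons1// [RHS]tonelli_cons1//; last first.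
  by move=> x; exact: integral_ge0.
apply: eq_integral => s _.
rewrite (IHn (fun z => F (rV_cons (s, z))) j)//.
  apply: eq_integral => z _.
  by apply: eq_integral => t _; rewrite rV_cons_insert.
exact: (measurableT_comp mF (measurableT_comp (@measurable_rV_cons _ R n.+1)
  (measurable_pair1 s))).
Qed.

End axis.

(** * Measurability and derivatives along lines *)

Section measurable_rV.
Variable R : realType.

(** The sigma-algebra is generated by the coordinates; an open set is the
    countable union of the cubes with rational centre and radius 1/(k+1) that
    it contains. *)
Lemma open_measurable_rV n (A : set 'rV[R]_n) : open A -> measurable A.
Proof.
move=> oA.
pose box (c : 'rV[rat]_n * nat) :=
  [set x : 'rV[R]_n | forall i, `|x ord0 i - ratr (c.1 ord0 i)| < c.2.+1%:R^-1].
pose F c := if `[< box c `<=` A >] then box c else set0.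
have -> : A = \bigcup_c F c.
  apply/seteqP; split=> [x Ax|x [c _]]; last first.
    by rewrite /F; case: asboolP => // bA; exact: bA.
  move: oA; rewrite openE => /(_ _ Ax)/nbhs_ballP[e /= e0 xeA].
  have [k ke] : exists k : nat, k.+1%:R^-1 < e / 2.
    have /ltr_add_invr[k] : 0 < e / 2 :> R by rewrite divr_gt0.
    by rewrite add0r; exists k.
  have k0 : 0 < k.+1%:R^-1 :> R by rewrite invr_gt0.
  have /choice[c cP] : forall i, exists q : rat,
      `|x ord0 i - ratr q| < k.+1%:R^-1.
    move=> i.
    have /rat_in_itvoo[q] : x ord0 i < x ord0 i + k.+1%:R^-1 by rewrite ltrDl.
    rewrite in_itv/= => /andP[xq qx]; exists q.
    by rewrite distrC gtr0_norm ?subr_gt0// ltrBlDl.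
  exists (\row_i c i, k) => //.
  rewrite /F asboolT; first by move=> i /=; rewrite mxE.
  move=> y yb; apply: xeA; split => // i j.
  rewrite (ord1 i) /ball /=.
  have := yb j; have := cP j; rewrite /= mxE => h1 h2.
  have -> : x ord0 j - y ord0 j =
    (x ord0 j - ratr (c j)) - (y ord0 j - ratr (c j)) by ring.
  rewrite (le_lt_trans (ler_normB _ _))//.
  by rewrite (lt_trans (ltrD h1 h2))// (lt_le_trans (ltrD ke ke))// -splitr.
apply: countable_bigcupT_measurable => [|c]; first exact: countableP.
rewrite /F; case: ifPn => // _.
have -> : box c = \bigcap_(i in [set: 'I_n]) ((fun x : 'rV[R]_n => x ord0 i) @^-1`
    ball (ratr (c.1 ord0 i) : R) (c.2.+1%:R^-1)).
  apply/seteqP; split=> x /= h i; first by rewrite /ball/= distrC => _; exact: h.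
  by have := h i I; rewrite /ball/= distrC.
apply: fin_bigcap_measurable => [|i _]; first exact: finite_finset.
rewrite -[X in measurable X]setTI; apply: measurable_coord => //.
by apply: open_measurable; exact: ball_open.
Qed.

Lemma continuous_measurable_rV n (f : 'rV[R]_n -> R) :
  continuous f -> measurable_fun [set: 'rV[R]_n] f.
Proof.
move=> /continuousP cf; apply: (measurability _ (RGenOpens.measurableE R)).
move=> /= _ [_ [a [b ->]] <-]; rewrite setTI; apply: open_measurable_rV.
by apply: cf; exact: interval_open.
Qed.

End measurable_rV.

Section line_derivative.
Variable R : realType.

(** A directional derivative is a derivative along a line, so that the
    one-dimensional calculus applies. *)
Lemma is_derive_lineP n (f : 'rV[R]_n -> R) x v d :
  is_derive x v f d <-> is_derive (0 : R) 1 (fun s => f (s *: v + x)) d.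
Proof.
have E : (fun h : R => h^-1 *: ((f \o shift x) (h *: v) - f x)) =
    (fun h : R => h^-1 *: (((fun s => f (s *: v + x)) \o shift (0 : R)) (h *: 1) -
      f ((0 : R) *: v + x))).
  by apply/funext => h /=; rewrite addr0 scale0r add0r [h *: 1]mulr1.
by split=> -[dv dE]; split; rewrite /derivable /derive ?E// -?E.
Qed.

Lemma is_derive_chain n (h : R -> R) (f : 'rV[R]_n -> R) x v a b :
  is_derive (f x) 1 h a -> is_derive x v f b -> is_derive x v (h \o f) (a * b).
Proof.
move=> dh /is_derive_lineP df; apply/is_derive_lineP.
apply: (@is_derive1_comp _ h (fun s => f (s *: v + x))) => //.
by rewrite scale0r add0r.
Qed.

Lemma is_derive_insert n (f : 'rV[R]_n.+1 -> R) (i : 'I_n.+1) t (y : 'rV[R]_n) :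
  derivable f (rV_insert i t y) (delta_mx ord0 i) ->
  is_derive t 1 (fun s => f (rV_insert i s y)) (partial i f (rV_insert i t y)).
Proof.
move=> df.
have E : (fun h : R => h^-1 *: (((fun s => f (rV_insert i s y)) \o shift t) (h *: 1)
      - f (rV_insert i t y))) =
    (fun h : R => h^-1 *: ((f \o shift (rV_insert i t y)) (h *: delta_mx ord0 i)
      - f (rV_insert i t y))).
  by apply/funext => h /=; rewrite [h *: 1]mulr1 rV_insertDdelta.
by split; rewrite /derivable /partial /derive E.
Qed.

End line_derivative.

(** * A smooth function flat at the origin *)

Section flat.
Variable R : realType.
Implicit Types (P : {poly R}) (s t : R).

Let root t : R := (Num.sqrt t)^-1.

(** With s = 1 / sqrt t, the functions P(s) exp(-s), extended by 0 to the
    left, are stable under differentiation; so each is smooth on the line. *)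
Definition flat P t : R := if 0 < t then P.[root t] * expR (- root t) else 0.

Lemma exprn_expRN_le m s : 0 <= s -> s ^+ m * expR (- s) <= m`!%:R.
Proof.
move=> s0; rewrite expRN ler_pdivrMr ?expR_gt0//.
case: m => [|m]; first by rewrite expr0 fact0 mul1r (le_trans _ (expR_ge1Dx s))// lerDl.
rewrite mulrC -ler_pdivrMr ?ltr0n ?fact_gt0//.
by rewrite (le_trans _ (expR_ge1Dxn m s0))// lerDr.
Qed.

Lemma flat_bounded P : exists2 K, 0 <= K & forall t, `|flat P t| <= K.
Proof.
exists (\sum_(i < size P) `|P`_i| * i`!%:R).
  by apply: sumr_ge0 => i _; rewrite mulr_ge0.
move=> t; rewrite /flat; case: ifPn => [t0|_]; last first.
  by rewrite normr0; apply: sumr_ge0 => i _; rewrite mulr_ge0.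
rewrite horner_coef mulr_suml (le_trans (ler_norm_sum _ _ _))//.
apply: ler_sum => i _; rewrite -mulrA normrM ler_wpM2l//.
by rewrite ger0_norm ?exprn_expRN_le// ?mulr_ge0 ?exprn_ge0 ?expR_ge0// invr_ge0.
Qed.

(** Since s ^+ 2 * t = 1, a factor t can be traded for s ^+ 2: every flat P is
    O(t), hence also O(t ^+ 2), near 0. *)
Lemma flatMX2 P t : flat P t = t * flat (P * 'X^2) t.
Proof.
rewrite /flat; case: ifPn => [t0|_]; last by rewrite mulr0.
rewrite hornerM hornerXn exprVn sqr_sqrtr ?ltW// mulrA [t * _]mulrC -(mulrA _.[_]).
by rewrite mulVf ?mulr1// gt_eqF.
Qed.

(** With s = 1 / sqrt t one has s' = - s ^+ 3 / 2, hence
    (P(s) exp(-s))' = (P(s) - P'(s)) s ^+ 3 / 2 * exp(-s). *)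
Definition flat_deriv P : {poly R} := 2^-1 *: ((P - P^`()) * 'X^3).

Let is_derive_root t : 0 < t -> is_derive t 1 root (- (2^-1 * root t ^+ 3)).
Proof.
move=> t0; have s0 : Num.sqrt t != 0 by rewrite gt_eqF// sqrtr_gt0.
have := is_derive1_sqrt t0 => d.
have dr : derivable root t 1 by exact: derivableV.
split=> //; rewrite /root deriveV// derive_val.
rewrite /GRing.scale/=.
by field.
Qed.

(** At t = 0 the difference quotient flat P h / h equals h * flat (P * 'X^4) h,
    which tends to 0 because flat functions are bounded. *)
Lemma is_derive_flat P t : is_derive t 1 (flat P) (flat (flat_deriv P) t).
Proof.
have [t0|t0|<-] := ltgtP 0 t.
- apply: (near_eq_is_derive (f := fun t => P.[root t] * expR (- root t))).
    near=> u; rewrite /flat ifT//; near: u.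
    exact: lt_nbhsr.
  have dr := is_derive_root t0.
  have dP : is_derive t 1 (fun t => P.[root t]) (P^`().[root t] * (- (2^-1 * root t ^+ 3))).
    exact: (is_derive1_comp (f := horner P) (g := root)).
  have dE : is_derive t 1 (fun t => expR (- root t))
      (expR (- root t) * (2^-1 * root t ^+ 3)).
    apply: (is_derive1_comp (f := expR) (g := fun t => - root t)).
    by rewrite -[X in is_derive _ _ _ X]opprK; exact: is_deriveN.
  have dM := is_deriveM dP dE; apply: is_derive_eq dM _.
  rewrite /flat t0 /flat_deriv /GRing.scale/= hornerZ hornerM hornerXn hornerD hornerN.
  by ring.
- apply: (near_eq_is_derive (f := cst 0)).
    near=> u; rewrite /flat ifF//; apply/negbTE; rewrite -leNgt ltW//; near: u.
    exact: lt_nbhsl.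
  by rewrite /flat ltNge ltW//; exact: is_derive_cst.
- rewrite [flat (flat_deriv P) 0]/flat ltxx.
  have [K K0 HK] := flat_bounded (P * 'X^2 * 'X^2).
  suff E : (fun h : R => h^-1 *: ((flat P \o shift 0) (h *: 1) - flat P 0)) @ 0^' --> (0 : R).
    by split; [apply/cvg_ex; exists 0 | exact/cvg_lim].
  have -> : (fun h : R => h^-1 *: ((flat P \o shift 0) (h *: 1) - flat P 0)) =
      (fun h => h^-1 * flat P h).
    apply/funext => h /=.
    by rewrite addr0 [h *: 1]mulr1 [flat P 0]/flat ltxx subr0.
  apply/norm_cvg0P.
  apply: (@squeeze_cvgr _ _ _ _ (cst 0) (fun h => K * `|h|)).
  - near=> h; rewrite normr_ge0/= flatMX2 mulKf; last first.
      by near: h; exact: nbhs_dnbhs_neq.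
    by rewrite flatMX2 normrM mulrC ler_wpM2r.
  - exact: cvg_cst.
  - rewrite -[X in _ --> X](mulr0 K); apply: cvgMr.
    apply: cvg_within_filter.
    have := @norm_continuous R R 0; rewrite /continuous_at normr0; exact.

Unshelve. all: by end_near. Qed.

Lemma continuous_flat P : continuous (flat P).
Proof.
by move=> t; apply/differentiable_continuous/derivable1_diffP; case: (is_derive_flat P t).
Qed.

End flat.

(** * Calculus of smooth functions *)

Section smooth_calculus.
Variable R : realType.
Implicit Types (n k : nat).

Lemma CkW n k (f : 'rV[R]_n -> R) : Ck k.+1 f -> Ck k f.
Proof.
elim: k f => [|k IHk] f [cf df]; split => // i.
by have [? ?] := df i; split => //; exact: IHk.
Qed.

Lemma Ck_cst n k (c : R) : Ck k (cst c : 'rV[R]_n -> R).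
Proof.
elim: k c => [|k IHk] c; split => //; try exact: cst_continuous.
move=> i; split; first by move=> x; exact: derivable_cst.
by have -> : partial i (cst c) = cst 0 by apply/funext => x; exact: derive_cst.
Qed.

Lemma CkD n k (f g : 'rV[R]_n -> R) : Ck k f -> Ck k g ->
  Ck k (fun x => f x + g x).
Proof.
elim: k f g => [|k IHk] f g [cf df] [cg dg];
  (split => //; first by move=> x; exact: (cvgD (cf x) (cg x))) => i.
have [dfi Cf] := df i; have [dgi Cg] := dg i.
split; first by move=> x; exact: (derivableD (dfi x) (dgi x)).
have -> : partial i (fun x => f x + g x) = fun x => partial i f x + partial i g x.
  by apply/funext => x; exact: (deriveD (dfi x) (dgi x)).
exact: IHk.
Qed.

Lemma partialM n i (f g : 'rV[R]_n -> R) x :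
  derivable f x (delta_mx ord0 i) -> derivable g x (delta_mx ord0 i) ->
  partial i (fun x => f x * g x) x = f x * partial i g x + g x * partial i f x.
Proof. by move=> df dg; exact: (deriveM df dg). Qed.

Lemma CkM n k (f g : 'rV[R]_n -> R) : Ck k f -> Ck k g ->
  Ck k (fun x => f x * g x).
Proof.
elim: k f g => [|k IHk] f g; first by
  move=> [cf _] [cg _]; split => // x; exact: (cvgM (cf x) (cg x)).
move=> Cf1 Cg1; have Cfk := CkW Cf1; have Cgk := CkW Cg1.
case: Cf1 Cg1 => cf df [cg dg].
split; first by move=> x; exact: (cvgM (cf x) (cg x)).
move=> i; have [dfi Cf] := df i; have [dgi Cg] := dg i.
split; first by move=> x; exact: (derivableM (dfi x) (dgi x)).
have -> : partial i (fun x => f x * g x) =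
    fun x => f x * partial i g x + g x * partial i f x.
  by apply/funext => x; exact: partialM.
by apply: CkD; exact: IHk.
Qed.

Lemma partial_flat n i P (f : 'rV[R]_n -> R) x :
  derivable f x (delta_mx ord0 i) ->
  is_derive x (delta_mx ord0 i) (fun x => flat P (f x))
    (flat (flat_deriv P) (f x) * partial i f x).
Proof.
move=> df; apply: (@is_derive_chain _ _ (flat P) f).
  exact: is_derive_flat.
exact: derivableP.
Qed.

Lemma Ck_flat n k P (f : 'rV[R]_n -> R) : Ck k f -> Ck k (fun x => flat P (f x)).
Proof.
have cflat Q (g : 'rV[R]_n -> R) : continuous g -> continuous (fun x => flat Q (g x)).
  by move=> cg x; apply: continuous_comp; [exact: cg|exact: continuous_flat].
elim: k P f => [|k IHk] P f; first by move=> [cf _]; split => //; exact: cflat.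
move=> Cf1; have Cfk := CkW Cf1; case: Cf1 => cf df; split; first exact: cflat.
move=> i; have [dfi Cf] := df i.
split; first by move=> x; case: (partial_flat P (dfi x)).
have -> : partial i (fun x => flat P (f x)) =
    fun x => flat (flat_deriv P) (f x) * partial i f x.
  by apply/funext => x; exact: (derive_val (is_derive := partial_flat P (dfi x))).
by apply: CkM => //; exact: IHk.
Qed.

Lemma Ck_coord n k (i : 'I_n) : Ck k (fun x : 'rV[R]_n => x ord0 i).
Proof.
have cc := @coord_continuous R 1 n ord0 i.
case: k => [|k]; split => // j.
have d x : is_derive x (delta_mx ord0 j) (fun x : 'rV[R]_n => x ord0 i) (i == j)%:R.
  apply/is_derive_lineP.
  have -> : (fun s : R => (s *: delta_mx ord0 j + x : 'rV[R]_n) ord0 i) =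
      (fun s : R => s * (i == j)%:R + x ord0 i).
    by apply/funext => s; rewrite !mxE eqxx.
  have dm : is_derive (0 : R) 1 (fun s : R => s * (i == j)%:R) (i == j)%:R.
    have := is_deriveM (is_derive_id (0 : R) 1) (is_derive_cst ((i == j)%:R : R) (0 : R) 1).
    by move/(is_derive_eq); apply; rewrite scaler0 add0r [LHS]mulr1.
  have := is_deriveD dm (is_derive_cst (x ord0 i : R) (0 : R) 1).
  by move/(is_derive_eq); apply; rewrite addr0.
split; first by move=> x; case: (d x).
have -> : partial j (fun x : 'rV[R]_n => x ord0 i) = cst (i == j)%:R.
  by apply/funext => x; exact: (derive_val (is_derive := d x)).
exact: Ck_cst.
Qed.

Lemma continuous_col' n (i : 'I_n) : continuous (@col' R 1 n i).
Proof.
move=> x s /nbhs_ballP[e /= e0 es]; apply/nbhs_ballP; exists e => //= y [_ xy].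
by apply: es; split => // a b; rewrite !mxE; exact: xy.
Qed.

Lemma Ck_col' n k (i : 'I_n) (f : 'rV[R]_n.-1 -> R) : Ck k f ->
  Ck k (fun x : 'rV[R]_n => f (col' i x)).
Proof.
have dcol (g : 'rV[R]_n.-1 -> R) x v d : is_derive (col' i x) (col' i v) g d ->
    is_derive x v (fun x : 'rV[R]_n => g (col' i x)) d.
  move=> /is_derive_lineP gd; apply/is_derive_lineP.
  have -> // : (fun s : R => g (col' i (s *: v + x))) =
      (fun s : R => g (s *: col' i v + col' i x)).
  by apply/funext => s; congr g; apply/rowP => j; rewrite !mxE.
have ccol (g : 'rV[R]_n.-1 -> R) : continuous g ->
    continuous (fun x : 'rV[R]_n => g (col' i x)).
  by move=> cg x; apply: continuous_comp; [exact: continuous_col'|exact: cg].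
elim: k f => [|k IHk] f; first by move=> [cf _]; split => //; exact: ccol.
move=> [cf df]; split; first exact: ccol.
move=> j; case: (unliftP i j) => [l jl|ji].
  have [dfl Cf] := df l.
  have d x : is_derive x (delta_mx ord0 j) (fun x : 'rV[R]_n => f (col' i x))
      (partial l f (col' i x)).
    apply: dcol; have -> : col' i (delta_mx ord0 j) = delta_mx ord0 l :> 'rV[R]_n.-1.
      by apply/rowP => m; rewrite !mxE jl (inj_eq lift_inj).
    exact: derivableP.
  split; first by move=> x; case: (d x).
  have -> : partial j (fun x : 'rV[R]_n => f (col' i x)) =
      fun x => partial l f (col' i x).
    by apply/funext => x; exact: (derive_val (is_derive := d x)).
  exact: IHk.
have d x : is_derive x (delta_mx ord0 j) (fun x : 'rV[R]_n => f (col' i x)) 0.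
  apply: dcol; have -> : col' i (delta_mx ord0 j) = 0 :> 'rV[R]_n.-1.
    by apply/rowP => m; rewrite !mxE ji [lift i m == i]eq_sym (negbTE (neq_lift _ _)) andbF.
  exact: is_derive0.
split; first by move=> x; case: (d x).
have -> : partial j (fun x : 'rV[R]_n => f (col' i x)) = cst 0.
  by apply/funext => x; exact: (derive_val (is_derive := d x)).
exact: Ck_cst.
Qed.

Lemma Ck_prod n k m (F : 'I_m -> 'rV[R]_n -> R) :
  (forall j, Ck k (F j)) -> Ck k (fun x => \prod_(j < m) F j x).
Proof.
elim: m F => [|m IHm] F CF.
  by under eq_fun do rewrite big_ord0; exact: Ck_cst.
under eq_fun do rewrite big_ord_recl.
by apply: CkM => //; exact: IHm.
Qed.

Lemma partial_eq0 n i (f : 'rV[R]_n -> R) x :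
  (\forall y \near x, f y = 0) -> partial i f x = 0.
Proof.
move=> f0; rewrite /partial (near_eq_derive _ (g := cst 0))//.
exact: derive_cst.
Qed.

End smooth_calculus.

(** * Power means and the one-dimensional Poincare inequality *)

Section power_mean.
Context d (T : measurableType d) (R : realType) (mu : {measure set T -> \bar R}).
Local Open Scope ereal_scope.

(** Hoelder's inequality against the constant 1 on D. *)
Lemma integral_powR_mono (D : set T) (f : T -> R) (a b : R) :
  measurable D -> measurable_fun D f -> (0 < a < b)%R ->
  \int[mu]_(x in D) (`|f x| `^ a)%:E <=
    (\int[mu]_(x in D) (`|f x| `^ b)%:E) `^ (a / b) * mu D `^ (1 - a / b).
Proof.
move=> mD mf /andP[a0 ab]; have b0 := lt_trans a0 ab.
have ab0 : (0 < a / b)%R by rewrite divr_gt0.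
have ab1 : (0 < 1 - a / b)%R by rewrite subr_gt0 ltr_pdivrMr// mul1r.
(* Hoelder with the exponents b / a and 1 / (1 - a / b). *)
pose F := (fun x => (`|f x| `^ a)%R) \_ D; pose G : T -> R := \1_D.
have mF : measurable_fun [set: T] F.
  apply/(measurable_restrictT _ mD).1.
  apply: (measurableT_comp (f := @powR R ^~ a)) => //.
  exact: measurableT_comp.
have mG : measurable_fun [set: T] G by exact: measurable_indic.
have P0 : (0 < b / a)%R by rewrite divr_gt0.
have := @hoelder _ _ _ mu F G (b / a)%R ((1 - a / b)^-1)%R mF mG.
rewrite P0 invr_gt0 ab1 invrK invf_div => /(_ isT isT).
rewrite addrC subrK => /(_ erefl).
rewrite unlock invr1 poweRe1; last first.
  by apply: integral_ge0 => x _; exact: poweR_ge0.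
rewrite invf_div invrK.
have -> : \int[mu]_x `|(EFin \o (F \* G)%R) x| `^ 1 =
    \int[mu]_(x in D) (`|f x| `^ a)%:E.
  rewrite [RHS]integral_mkcond; apply: eq_integral => x _.
  rewrite /= powRr1// /F /G /= !patchE indicE.
  by case: ifPn => xD; rewrite ?mulr1 ?mul0r ?normr0// ger0_norm// powR_ge0.
have -> : \int[mu]_x `|(EFin \o F) x| `^ (b / a) =
    \int[mu]_(x in D) (`|f x| `^ b)%:E.
  rewrite [RHS]integral_mkcond; apply: eq_integral => x _.
  rewrite /= /F !patchE; case: ifPn => xD.
    by rewrite ger0_norm ?powR_ge0// -powRrM mulrC divfK// gt_eqF.
  by rewrite normr0 powR0// gt_eqF.
have -> // : \int[mu]_x `|(EFin \o G) x| `^ (1 - a / b)^-1 = mu D.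
rewrite -[RHS]mul1e -integral_cst// [RHS]integral_mkcond.
apply: eq_integral => x _; rewrite /= /G indicE patchE; case: ifPn => xD.
  by rewrite normr1 powR1.
by rewrite normr0 powR0// gt_eqF// invr_gt0.
Qed.

Lemma integral_supported (D : set T) (f : T -> \bar R) :
  (forall x, f x != 0 -> D x) -> \int[mu]_(x in D) f x = \int[mu]_x f x.
Proof.
move=> fD; rewrite integral_mkcond; congr integral; apply/funext => x.
rewrite patchE; case: ifPn => // /negP xD.
by apply/eqP; apply: contra_notT xD; rewrite eq_sym => /fD /mem_set.
Qed.

End power_mean.

Section line.
Variable R : realType.
Local Open Scope ereal_scope.

Lemma integral_lebesgue_R (D : set R) (f : R -> \bar R) :
  measurable D -> measurable_fun D f -> (forall x, D x -> 0 <= f x) ->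
  \int[@lebesgue_R R]_(x in D) f x = \int[@lebesgue_measure R]_(x in D) f x.
Proof.
move=> mD mf f0.
have mid : measurable_fun [set: measurableTypeR R] (id : measurableTypeR R -> R).
  by move=> _ Y mY; rewrite setTI; exact: mY.
transitivity (\int[pushforward (@lebesgue_measure R)
    (id : measurableTypeR R -> R)]_(x in D) f x).
  by apply: eq_measure_integral => A mA AD.
rewrite (ge0_integral_pushforward mid)//.
by move=> y /set_mem; exact: f0.
Qed.

Section antiderivative.
Variables F F' : R -> R.
Hypothesis dF : forall t, is_derive (t : R) (1%R : R) F (F' t).
Hypothesis cF' : continuous F'.

Let cF : continuous F.
Proof.
by move=> t; apply/differentiable_continuous/derivable1_diffP; case: (dF t).
Qed.

Lemma integral_derivative (a b : R) : (a < b)%R ->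
  \int[lebesgue_measure]_(t in `[a, b]) (F' t)%:E = (F b - F a)%:E.
Proof.
move=> ab; rewrite (@continuous_FTC2 _ F' F)//.
- by apply: continuous_subspaceT => x; exact: cF'.
- split.
  + by move=> t _; case: (dF t).
  + by apply: cvg_at_right_filter; exact: cF.
  + by apply: cvg_at_left_filter; exact: cF.
- by move=> t _; rewrite derive1E; case: (dF t).
Qed.

Let mF' D : measurable_fun D F'.
Proof. by apply: measurable_funTS; exact: continuous_measurable_fun. Qed.

Let mnF' D : measurable_fun D (fun t => `|F' t|%:E).
Proof. by apply/measurable_EFinP; exact: measurableT_comp. Qed.

Lemma derivative_osc (a b t : R) : (a <= t <= b)%R ->
  `|F t - F a|%:E <= \int[@lebesgue_R R]_(t in `[a, b]) `|F' t|%:E.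
Proof.
move=> /andP[]; rewrite le_eqVlt => /predU1P[<- _|at0 tb].
  by rewrite subrr normr0; apply: integral_ge0.
rewrite integral_lebesgue_R// -abse_EFin -integral_derivative//.
apply: (@le_trans _ _ (\int[lebesgue_measure]_(t in `[a, t]) `|F' t|%:E)).
  apply: le_abse_integral => //.
  by apply/measurable_EFinP; exact: mF'.
apply: ge0_subset_integral => //; first exact: mnF'.
by apply: subset_itvl; rewrite bnd_simp.
Qed.

(** Each value of F is bounded by the integral of `|F'|, hence by a power of
    the integral of `|F'| `^ p (integral_powR_mono); integrate over [a, b]. *)
Lemma poincare_line (a b p : R) : (a < b)%R -> (1 < p)%R -> F a = 0%R ->
  \int[@lebesgue_R R]_(t in `[a, b]) (`|F t| `^ p)%:E <=
  ((b - a) `^ p)%:E * \int[@lebesgue_R R]_(t in `[a, b]) (`|F' t| `^ p)%:E.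
Proof.
move=> ab p1 Fa; have p0 : (0 < p)%R by rewrite (lt_trans _ p1).
have ba0 : (0 < b - a)%R by rewrite subr_gt0.
have mab : @lebesgue_R R `[a, b] = (b - a)%:E.
  by rewrite /lebesgue_R lebesgue_measure_itv/= lte_fin ab.
set I := \int[@lebesgue_R R]_(t in `[a, b]) (`|F' t| `^ p)%:E.
have I0 : 0 <= I by apply: integral_ge0 => t _; rewrite lee_fin powR_ge0.
have H : \int[@lebesgue_R R]_(t in `[a, b]) `|F' t|%:E <=
    I `^ p^-1 * ((b - a) `^ (1 - p^-1))%:E.
  have := @integral_powR_mono _ _ _ (@lebesgue_R R) `[a, b]%classic F' 1 p.
  rewrite ltr01 p1 div1r /= mab => /(_ (measurable_itv _) (@mF' _) isT).
  apply: le_trans.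
  by under eq_integral do rewrite -[X in X%:E]powRr1//.
have key t : t \in `[a, b]%R -> (`|F t| `^ p)%:E <= I * ((b - a) `^ (p - 1))%:E.
  rewrite in_itv/= => /derivative_osc; rewrite Fa subr0 => /le_trans/(_ H) h.
  have E : (I `^ p^-1 * ((b - a) `^ (1 - p^-1))%:E) `^ p = I * ((b - a) `^ (p - 1))%:E.
    rewrite poweRM ?poweR_ge0 ?lee_fin ?powR_ge0//.
    rewrite -poweRrM mulVf ?gt_eqF// poweRe1// poweR_EFin -powRrM.
    by rewrite mulrBl mul1r mulVf ?gt_eqF.
  rewrite -E -(poweR_EFin `|F t|); apply: (gt0_ler_poweR (ltW p0)) => //.
  + by rewrite in_itv/= lee_fin normr_ge0 leey.
  + by rewrite in_itv/= leey andbT mule_ge0 ?poweR_ge0 ?lee_fin ?powR_ge0.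
apply: (@le_trans _ _ (\int[@lebesgue_R R]_(t in `[a, b])
    (cst (I * ((b - a) `^ (p - 1))%:E) t))).
  apply: ge0_le_integral => //.
  apply/measurable_EFinP; apply: (measurableT_comp (f := @powR R ^~ p)) => //.
  apply: measurableT_comp => //; apply: measurable_funTS.
  exact: continuous_measurable_fun.
rewrite integral_cst//; rewrite /= mab -muleA muleC lee_wpmul2r// -EFinM lee_fin.
rewrite -[X in (_ * X)%R]powRr1 ?(ltW ba0)// -powRD ?subrK//.
by apply/implyP => _; rewrite gt_eqF.
Qed.

End antiderivative.

End line.

(** * Test functions and bounded open sets *)

Section test_functions.
Variables (R : realType) (n : nat) (Omega : set 'rV[R]_n).
Implicit Types phi psi : 'rV[R]_n -> R.

Lemma smooth_continuous phi : smooth phi -> continuous phi.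
Proof. by move=> /(_ 0%N) []. Qed.

Lemma smooth_derivable phi i x : smooth phi -> derivable phi x (delta_mx ord0 i).
Proof. by move=> /(_ 1%N)[_ /(_ i)[]]. Qed.

Lemma smooth_partial phi i : smooth phi -> smooth (partial i phi).
Proof. by move=> sphi k; have [_ /(_ i)[]] := sphi k.+1. Qed.

Lemma test_function_in (C : set 'rV[R]_n) phi : smooth phi -> compact C ->
  C `<=` Omega -> (forall x, phi x != 0 -> C x) -> test_function Omega phi.
Proof.
move=> sphi cC CO phiC.
have clC : closed C by apply: compact_closed => //; exact: norm_hausdorff.
have sub : closure [set x | phi x != 0] `<=` C.
  by rewrite [X in _ `<=` X](iffLR (closure_id C) clC); exact: closure_subset.
split => //; last exact: (subset_trans sub).
by apply: (subclosed_compact _ cC sub); exact: closed_closure.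
Qed.

Lemma test_function0 : test_function Omega (cst 0).
Proof.
apply: (@test_function_in set0); first by move=> k; exact: Ck_cst.
- exact: compact0.
- exact: sub0set.
- by move=> x; rewrite /= eqxx.
Qed.

Lemma test_functionD phi psi : test_function Omega phi ->
  test_function Omega psi -> test_function Omega (fun x => phi x + psi x).
Proof.
move=> [sphi c1 s1] [spsi c2 s2].
apply: (@test_function_in (closure [set x | phi x != 0] `|`
  closure [set x | psi x != 0])).
- by move=> k; exact: CkD.
- exact: compactU.
- by move=> x [/s1|/s2].
- move=> x; have [->|p0 _] := eqVneq (phi x) 0; last by left; exact: subset_closure.
  by rewrite add0r => p0; right; exact: subset_closure.
Qed.

Lemma test_functionM phi psi : test_function Omega phi ->
  smooth psi -> test_function Omega (fun x => phi x * psi x).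
Proof.
move=> [sphi c1 s1] spsi.
apply: (@test_function_in (closure [set x | phi x != 0])) => //.
- by move=> k; exact: CkM.
- by move=> x; rewrite mulf_eq0 negb_or => /andP[p0 _]; exact: subset_closure.
Qed.

Lemma test_functionZ (c : R) phi : test_function Omega phi ->
  test_function Omega (fun x => c * phi x).
Proof.
move=> tphi; have := @test_functionM phi (cst c) tphi (fun k => @Ck_cst R n k c).
by congr test_function; apply/funext => x; rewrite mulrC.
Qed.

(** If phi vanishes near x then so do its derivatives. *)
Lemma test_function_partial i phi : test_function Omega phi ->
  test_function Omega (partial i phi).
Proof.
move=> [sphi c1 s1]; apply: (@test_function_in (closure [set x | phi x != 0])) => //.
  exact: smooth_partial.
move=> x /eqP px; apply: contrapT => xS; apply: px; apply: partial_eq0.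
have : nbhs x (~` closure [set x | phi x != 0]).
  by apply: open_nbhs_nbhs; split=> //; exact/closed_openC/closed_closure.
apply: filterS => y yS; apply/eqP; apply: contra_notT yS => py.
exact: subset_closure.
Qed.

Lemma test_function_supp phi x : test_function Omega phi -> phi x != 0 -> Omega x.
Proof. by move=> [_ _ s1] p0; apply: s1; exact: subset_closure. Qed.

Lemma continuous_compact_bounded (C : set 'rV[R]_n) (f : 'rV[R]_n -> R) :
  compact C -> continuous f -> exists2 K, 0 <= K & forall x, C x -> `|f x| <= K.
Proof.
move=> cC cf.
have /compact_bounded[K [_ HK]] : compact (f @` C).
  by apply: continuous_compact => //; exact: continuous_subspaceT.
exists (`|K| + 1); first by rewrite addr_ge0.
by move=> x Cx; apply: (HK (`|K| + 1)) => /=;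
  [rewrite (le_lt_trans (ler_norm K))// ltrDl|exists x].
Qed.

Lemma test_function_bounded phi : test_function Omega phi ->
  exists2 K, 0 <= K & forall x, `|phi x| <= K.
Proof.
move=> [sphi c1 s1].
have [K K0 HK] := continuous_compact_bounded c1 (smooth_continuous sphi).
exists K => // x; have [->|p0] := eqVneq (phi x) 0; first by rewrite normr0.
by apply: HK; exact: subset_closure.
Qed.

Lemma test_function_measurable phi : test_function Omega phi ->
  measurable_fun [set: 'rV[R]_n] phi.
Proof. by move=> [sphi _ _]; apply: continuous_measurable_rV; exact: smooth_continuous. Qed.

End test_functions.

Section domain.
Variables (R : realType) (n : nat) (Omega : set 'rV[R]_n).

Lemma bounded_set_box : bounded_set Omega ->
  exists2 M : R, 0 < M & forall x i, Omega x -> `|x ord0 i| < M.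
Proof.
move=> [K [_ HK]]; exists (`|K| + 2); first by rewrite ltr_wpDl.
move=> x i Ox; have := HK (`|K| + 1) _ x Ox.
rewrite (le_lt_trans (ler_norm K)) ?ltrDl// => /(_ isT).
rewrite /Num.norm/= mx_normrE => h.
apply: (@le_lt_trans _ _ (`|K| + 1)); last by rewrite ltrD2l ltr1n.
by apply: le_trans h; exact: (le_bigmax _ _ (ord0, i)).
Qed.

Lemma rV_box_measurable (A : 'I_n -> set R) : (forall i, measurable (A i)) ->
  measurable [set x : 'rV[R]_n | forall i, A i (x ord0 i)].
Proof.
move=> mA.
have -> : [set x : 'rV[R]_n | forall i, A i (x ord0 i)] =
    \bigcap_(i in [set: 'I_n]) (fun x : 'rV[R]_n => x ord0 i) @^-1` A i.
  by apply/seteqP; split => x /= H i //=; exact: H.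
apply: fin_bigcap_measurable => [|i _]; first exact: finite_finset.
by rewrite -[X in measurable X]setTI; apply: measurable_coord.
Qed.

Lemma lebesgue_rV_bounded : open Omega -> bounded_set Omega ->
  (lebesgue_rV n Omega < +oo)%E.
Proof.
move=> oO /bounded_set_box[M M0 HM].
pose A (_ : 'I_n) : set R := `[- M, M]%classic.
have mA i : measurable (A i) by exact: measurable_itv.
apply: (@le_lt_trans _ _ (lebesgue_rV n [set x | forall i, A i (x ord0 i)])).
  apply: le_measure; rewrite ?inE.
  - exact: open_measurable_rV.
  - exact: rV_box_measurable.
  - by move=> x Ox i; rewrite /A/= in_itv/= -ler_norml ltW// HM.
rewrite lebesgue_rV_box//.
have -> : (\prod_(i < n) lebesgue_measure (A i) = \prod_(i < n) (M + M)%:E)%E.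
  apply: eq_bigr => i _; rewrite /A lebesgue_measure_itv/= lte_fin.
  by rewrite ifT ?opprK// (lt_trans _ M0)// oppr_lt0.
by rewrite prodEFin ltry.
Qed.

Lemma lebesgue_rV_open_gt0 : open Omega -> Omega !=set0 ->
  (0 < lebesgue_rV n Omega)%E.
Proof.
move=> oO [a Oa].
move: (oO); rewrite openE => /(_ _ Oa)/nbhs_ballP[e /= e0 aeO].
pose A (i : 'I_n) : set R := `](a ord0 i - e), (a ord0 i + e)[%classic.
have mA i : measurable (A i) by exact: measurable_itv.
apply: (@lt_le_trans _ _ (lebesgue_rV n [set x | forall i, A i (x ord0 i)])).
  rewrite lebesgue_rV_box//.
  have -> : (\prod_(i < n) lebesgue_measure (A i) = \prod_(i < n) (e + e)%:E)%E.
    apply: eq_bigr => i _; rewrite /A lebesgue_measure_itv/= lte_fin.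
    rewrite ifT; first by rewrite EFinN -EFinB; congr EFin; ring.
    by rewrite ltrBlDr -addrA ltrDl addr_gt0.
  by rewrite prodEFin lte_fin; apply: prodr_gt0 => i _; rewrite addr_gt0.
apply: le_measure; rewrite ?inE.
- exact: rV_box_measurable.
- exact: open_measurable_rV.
- move=> x /= xA; apply: aeO; split => // j i; rewrite (ord1 j).
  by have := xA i; rewrite /A/= in_itv/= /ball/= -ltr_distl distrC.
Qed.

End domain.

(** * Integration by parts for test functions *)

Section integration_by_parts.
Variables (R : realType) (n : nat) (Omega : set 'rV[R]_n.+1).
Hypotheses (oO : open Omega) (bO : bounded_set Omega).
Implicit Types phi psi : 'rV[R]_n.+1 -> R.
Local Open Scope ereal_scope.
Local Notation mu := (lebesgue_rV n.+1).

Let mO : measurable Omega. Proof. exact: open_measurable_rV. Qed.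

Lemma test_function_integrable phi : test_function Omega phi ->
  mu.-integrable Omega (EFin \o phi).
Proof.
move=> tphi; apply: measurable_bounded_integrable => //.
- exact: lebesgue_rV_bounded.
- exact: (measurable_funTS (test_function_measurable tphi)).
- have [K K0 HK] := test_function_bounded tphi.
  exists K; split; first exact: num_real.
  by move=> k Kk x _ /=; rewrite (le_trans (HK x))// ltW.
Qed.

Section along_axis.
Variables (i : 'I_n.+1) (y : 'rV[R]_n).

Lemma test_function_line phi (t : R) : test_function Omega phi ->
  is_derive t (1%R : R) (fun s => phi (rV_insert i s y))
    (partial i phi (rV_insert i t y)).
Proof. by move=> [sphi _ _]; apply: is_derive_insert; exact: smooth_derivable. Qed.

Lemma test_function_line_continuous phi : test_function Omega phi ->
  continuous (fun t => phi (rV_insert i t y)).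
Proof.
move=> tphi t; apply/differentiable_continuous/derivable1_diffP.
by case: (test_function_line t tphi).
Qed.

Lemma test_function_line_supp (M : R) phi (t : R) :
  (forall x i, Omega x -> `|x ord0 i| < M)%R ->
  test_function Omega phi -> phi (rV_insert i t y) != 0%R -> (- M < t < M)%R.
Proof.
move=> OM tphi /(test_function_supp tphi) Ox; have := OM _ i Ox.
by rewrite rV_insert_id ltr_norml.
Qed.

(** Along each line parallel to an axis, a derivative of a test function has
    integral 0; this equates the positive and the negative parts. *)
Lemma line_integral_partial phi : test_function Omega phi ->
  \int[@lebesgue_R R]_t (EFin \o partial i phi)^\+ (rV_insert i t y) =
  \int[@lebesgue_R R]_t (EFin \o partial i phi)^\- (rV_insert i t y).
Proof.
move=> tphi; have tdphi := test_function_partial i tphi.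
have [M M0 OM] := bounded_set_box bO.
pose g t := partial i phi (rV_insert i t y).
have cg : continuous g := test_function_line_continuous tdphi.
have mg D : measurable_fun D (EFin \o g).
  by apply/measurable_EFinP/measurable_funTS; exact: continuous_measurable_fun.
(* the line integrals only see the interval ]- M, M[ *)
have E (h : R -> \bar R) : measurable_fun setT h -> (forall t, 0 <= h t) ->
    (forall t, g t = 0%R -> h t = 0) ->
    \int[@lebesgue_R R]_t h t = \int[lebesgue_measure]_(t in `[(- M)%R, M]%classic) h t.
  move=> mh h0 hg.
  rewrite -(@integral_supported _ _ _ (@lebesgue_R R) `[(- M)%R, M]%classic).
    by rewrite integral_lebesgue_R//; exact: measurable_funTS.
  move=> t ht0; have gt0 : g t != 0%R by apply: contra_neq ht0 => /hg.
  have /andP[? ?] := test_function_line_supp OM tdphi gt0.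
  by rewrite /= in_itv/= !ltW.
have Ep : \int[@lebesgue_R R]_t (EFin \o g)^\+ t =
    \int[lebesgue_measure]_(t in `[(- M)%R, M]%classic) (EFin \o g)^\+ t.
  apply: E => //; first exact: measurable_funepos.
  by move=> t gt0; rewrite funeposE/= gt0 maxxx.
have En : \int[@lebesgue_R R]_t (EFin \o g)^\- t =
    \int[lebesgue_measure]_(t in `[(- M)%R, M]%classic) (EFin \o g)^\- t.
  apply: E => //; first exact: measurable_funeneg.
  by move=> t gt0; rewrite funenegE/= gt0 oppr0 maxxx.
under eq_integral => t _ do rewrite funeposE/= -[partial _ _ _]/(g t).
under [RHS]eq_integral => t _ do rewrite funenegE/= -[partial _ _ _]/(g t).
under eq_integral => t _ do rewrite -[maxe _ _](funeposE (EFin \o g)).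
under [RHS]eq_integral => t _ do rewrite -[maxe _ _](funenegE (EFin \o g)).
rewrite Ep En.
have := @integral_derivative _ _ g (fun t => test_function_line t tphi) cg (- M)%R M.
have -> : phi (rV_insert i M y) = 0%R.
  apply/eqP; apply: contraT => /(test_function_line_supp OM tphi).
  by rewrite ltxx andbF.
have -> : phi (rV_insert i (- M)%R y) = 0%R.
  apply/eqP; apply: contraT => /(test_function_line_supp OM tphi).
  by rewrite ltxx.
rewrite subrr gtrN// => /(_ isT); rewrite integralE.
set a := (X in X - _ = _ -> _); set b := (X in _ - X = _ -> _).
have : 0 <= a by exact: integral_ge0.
have : 0 <= b by exact: integral_ge0.
rewrite -/a -/b.
case: a => [a| |]; case: b => [b| |] //= _ _ [/eqP].
by rewrite subr_eq0 => /eqP ->.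
Qed.

End along_axis.

(** Fubini along the i-th axis, applied separately to the positive and negative
    parts, whose integrals agree on every line. *)
Lemma integral_partial i phi : test_function Omega phi ->
  \int[mu]_(x in Omega) (partial i phi x)%:E = 0.
Proof.
move=> tphi; have tdphi := test_function_partial i tphi.
have mphi := test_function_measurable tdphi.
have mf : measurable_fun setT (EFin \o partial i phi) by exact/measurable_EFinP.
have fO (h : 'rV[R]_n.+1 -> \bar R) : (forall x, partial i phi x = 0%R -> h x = 0) ->
    \int[mu]_(x in Omega) h x = \int[mu]_x h x.
  move=> hx; apply: integral_supported => x h0.
  by apply: (test_function_supp tdphi); apply: contra_neq h0 => /hx.
have E : \int[mu]_(x in Omega) (EFin \o partial i phi)^\+ x =
    \int[mu]_(x in Omega) (EFin \o partial i phi)^\- x.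
  rewrite !fO.
  - rewrite (tonelli_axis i) ?[RHS](tonelli_axis i)//.
    + by apply: eq_integral => y _; exact: line_integral_partial.
    + exact: measurable_funeneg.
    + exact: measurable_funepos.
  - by move=> x h; rewrite funenegE/= h oppr0 maxxx.
  - by move=> x h; rewrite funeposE/= h maxxx.
rewrite integralE E subee//.
exact: (integrable_neg_fin_num mO (test_function_integrable tdphi)).
Qed.

(** The product phi * psi is a test function, so the integral of its partial
    derivative vanishes. *)
Lemma test_function_weak_gradient phi : test_function Omega phi ->
  weak_gradient Omega phi (fun x => \row_i partial i phi x)%R.
Proof.
move=> tphi i psi tpsi.
have spsi : smooth psi by case: tpsi.
have sphi : smooth phi by case: tphi.
have t1 := test_functionM tphi (smooth_partial i spsi).
have t2 := test_functionM tpsi (smooth_partial i sphi).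
have := integral_partial i (test_functionM tphi spsi).
have -> : \int[mu]_(x in Omega) (partial i (fun x => phi x * psi x) x)%:E =
    \int[mu]_(x in Omega) ((phi x * partial i psi x)%:E +
      (psi x * partial i phi x)%:E).
  apply: eq_integral => x _; rewrite -EFinD partialM//; exact: smooth_derivable.
rewrite integralD//; [|exact: test_function_integrable..].
have f1 := integrable_fin_num mO (test_function_integrable t1).
have f2 := integrable_fin_num mO (test_function_integrable t2).
have -> : (\int[mu]_(x in Omega) ((\row_j partial j phi x)%R ord0 i * psi x))%R =
    fine (\int[mu]_(x in Omega) (psi x * partial i phi x)%:E).
  by rewrite /Rintegral; congr fine; apply: eq_integral => x _; rewrite mxE mulrC.
rewrite /Rintegral; move: f1 f2 => /=.
case: (\int[mu]_(x in Omega) (phi x * partial i psi x)%:E) => [u| |]// _.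
case: (\int[mu]_(x in Omega) (psi x * partial i phi x)%:E) => [v| |]// _.
by move=> [/eqP]; rewrite addr_eq0 => /eqP.
Qed.


End integration_by_parts.

(** * Lebesgue norms on the domain *)

Section Lp_norm.
Variables (R : realType) (n : nat) (Omega : set 'rV[R]_n) (p : R).
Hypotheses (oO : open Omega) (bO : bounded_set Omega) (p1 : 1 < p).
Implicit Types f g : 'rV[R]_n -> R.
Local Open Scope ereal_scope.
Local Notation mu := (lebesgue_rV n).

Let mO : measurable Omega. Proof. exact: open_measurable_rV. Qed.
Let p0 : (0 < p)%R. Proof. exact: lt_trans p1. Qed.
Let pN0 : (p != 0)%R. Proof. by rewrite gt_eqF. Qed.

Lemma Lp_normE f :
  Lp_norm Omega p f = (\int[mu]_(x in Omega) (`|f x| `^ p)%:E) `^ p^-1.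
Proof.
rewrite /Lp_norm unlock; congr (_ `^ _).
rewrite [RHS]integral_mkcond; apply: eq_integral => x _ /=.
by rewrite !patchE; case: ifPn => // _; rewrite normr0 powR0.
Qed.

Lemma Lp_norm_powR f :
  Lp_norm Omega p f `^ p = \int[mu]_(x in Omega) (`|f x| `^ p)%:E.
Proof.
rewrite Lp_normE -poweRrM mulVf// poweRe1//.
by apply: integral_ge0 => x _; rewrite lee_fin powR_ge0.
Qed.

Lemma Lp_norm_ge0 f : 0 <= Lp_norm Omega p f.
Proof. exact: Lnorm_ge0. Qed.

Lemma measurable_norm_powR f q : measurable_fun Omega f ->
  measurable_fun Omega (fun x => (`|f x| `^ q)%:E).
Proof.
move=> mf; apply/measurable_EFinP.
apply: (measurableT_comp (f := @powR R ^~ q)) => //.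
exact: measurableT_comp.
Qed.

Lemma le_Lp_norm f g : measurable_fun Omega f -> measurable_fun Omega g ->
  (forall x, Omega x -> `|f x| <= `|g x|)%R ->
  Lp_norm Omega p f <= Lp_norm Omega p g.
Proof.
move=> mf mg fg; rewrite !Lp_normE.
have I0 h : 0 <= \int[mu]_(x in Omega) (`|h x| `^ p)%:E.
  by apply: integral_ge0 => x _; rewrite lee_fin powR_ge0.
apply: gt0_ler_poweR.
- by rewrite invr_ge0 ltW.
- by rewrite in_itv/= I0 leey.
- by rewrite in_itv/= I0 leey.
- apply: ge0_le_integral => //; try exact: measurable_norm_powR.
  + by move=> x Ox; rewrite lee_fin ge0_ler_powR ?nnegrE ?(ltW p0)// fg.
Qed.

Lemma Lp_normZ (c : R) f : measurable_fun Omega f ->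
  Lp_norm Omega p (fun x => c * f x)%R = `|c|%:E * Lp_norm Omega p f.
Proof.
move=> mf; rewrite !Lp_normE.
have -> : \int[mu]_(x in Omega) (`|c * f x| `^ p)%:E =
    (`|c| `^ p)%:E * \int[mu]_(x in Omega) (`|f x| `^ p)%:E.
  rewrite -ge0_integralZl//; last first.
    exact: measurable_norm_powR.
  by apply: eq_integral => x _; rewrite normrM powRM.
rewrite poweRM ?lee_fin ?powR_ge0//; last first.
  by apply: integral_ge0 => x _; rewrite lee_fin powR_ge0.
by rewrite poweR_EFin -powRrM mulfV// powRr1.
Qed.

Lemma Lp_normD f g : measurable_fun Omega f -> measurable_fun Omega g ->
  Lp_norm Omega p (fun x => f x + g x)%R <= Lp_norm Omega p f + Lp_norm Omega p g.
Proof.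
move=> mf mg; rewrite /Lp_norm.
have /(measurable_restrictT _ mO).1 mf' := mf.
have /(measurable_restrictT _ mO).1 mg' := mg.
have := @minkowski_EFin _ _ _ mu (f \_ Omega) (g \_ Omega) p mf' mg' (ltW p1).
apply: le_trans; rewrite le_eqVlt; apply/predU1P; left; apply: eq_Lnorm => x.
by rewrite /= !patchE; case: ifPn => //; rewrite addr0.
Qed.

Lemma in_LpZ (c : R) f : in_Lp Omega p f -> in_Lp Omega p (fun x => c * f x)%R.
Proof.
move=> [mf lf]; split; first exact: measurable_funM.
by rewrite Lp_normZ// lte_mul_pinfty// lee_fin.
Qed.

Lemma bounded_integral_powR (K : R) f : (0 <= K)%R -> measurable_fun Omega f ->
  (forall x, Omega x -> `|f x| <= K)%R ->
  \int[mu]_(x in Omega) (`|f x| `^ p)%:E <= (K `^ p)%:E * mu Omega.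
Proof.
move=> K0 mf fK; rewrite -integral_cst//; apply: ge0_le_integral => //.
- exact: measurable_norm_powR.
- by move=> x Ox; rewrite lee_fin ge0_ler_powR ?nnegrE ?(ltW p0)// fK.
Qed.

Lemma bounded_in_Lp (K : R) f : (0 <= K)%R -> measurable_fun Omega f ->
  (forall x, Omega x -> `|f x| <= K)%R -> in_Lp Omega p f.
Proof.
move=> K0 mf fK; split => //; rewrite Lp_normE poweR_lty//.
rewrite (le_lt_trans (bounded_integral_powR K0 mf fK))//.
by rewrite lte_mul_pinfty ?lee_fin ?powR_ge0//; exact: lebesgue_rV_bounded.
Qed.

Lemma test_function_in_Lp phi : test_function Omega phi -> in_Lp Omega p phi.
Proof.
move=> tphi; have [K K0 HK] := test_function_bounded tphi.
apply: (bounded_in_Lp K0) => //.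
exact: (measurable_funTS (test_function_measurable tphi)).
Qed.

Lemma in_Lp_integral_lty f (q : R) : (0 < q < p)%R -> in_Lp Omega p f ->
  \int[mu]_(x in Omega) (`|f x| `^ q)%:E < +oo.
Proof.
move=> qp [mf lf]; apply: le_lt_trans (integral_powR_mono _ mO mf qp) _.
apply: lte_mul_pinfty; first exact: poweR_ge0.
- rewrite ge0_fin_numE ?poweR_ge0// poweR_lty// -Lp_norm_powR.
  exact: poweR_lty.
- by apply: poweR_lty; exact: lebesgue_rV_bounded.
Qed.

Lemma in_Lp_test_integrable f phi : in_Lp Omega p f -> test_function Omega phi ->
  mu.-integrable Omega (EFin \o (fun x => f x * phi x)%R).
Proof.
move=> Lf tphi; have [mf _] := Lf.
have mphi := measurable_funTS (D := Omega) (test_function_measurable tphi).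
have [K K0 HK] := test_function_bounded tphi.
apply/integrableP; split; first exact/measurable_EFinP/measurable_funM.
apply: (@le_lt_trans _ _ (\int[mu]_(x in Omega) (K%:E * (`|f x| `^ 1)%:E))).
  apply: ge0_le_integral => //.
  - apply: measurableT_comp => //.
    exact/measurable_EFinP/measurable_funM.
  - by apply: measurable_funeM; exact: measurable_norm_powR.
  - move=> x Ox; rewrite -EFinM lee_fin normrM powRr1// mulrC.
    by rewrite ler_wpM2r.
rewrite ge0_integralZl//; last exact: measurable_norm_powR.
by rewrite lte_mul_pinfty// in_Lp_integral_lty// ltr01.
Qed.

End Lp_norm.

Section euclidean_norm.
Variables (R : realType) (n : nat).

Lemma euclidean_norm_ge0 (x : 'rV[R]_n) : 0 <= euclidean_norm x.
Proof. exact: sqrtr_ge0. Qed.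

Lemma le_euclidean_norm (x : 'rV[R]_n) i : `|x ord0 i| <= euclidean_norm x.
Proof.
rewrite /euclidean_norm -sqrtr_sqr ler_wsqrtr// (bigD1 i)//= lerDl.
by apply: sumr_ge0 => j _; exact: sqr_ge0.
Qed.

Lemma euclidean_norm_le (x : 'rV[R]_n) K : 0 <= K ->
  (forall i, `|x ord0 i| <= K) -> euclidean_norm x <= Num.sqrt n%:R * K.
Proof.
move=> K0 xK; rewrite -[X in _ * X]ger0_norm// -sqrtr_sqr -sqrtrM//.
apply: ler_wsqrtr; apply: (@le_trans _ _ (\sum_(i < n) K ^+ 2)).
  apply: ler_sum => i _; rewrite -real_normK ?num_real//.
  by rewrite lerXn2r ?nnegrE.
by rewrite sumr_const card_ord mulr_natl.
Qed.

Lemma euclidean_normZ c (x : 'rV[R]_n) :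
  euclidean_norm (c *: x) = `|c| * euclidean_norm x.
Proof.
rewrite /euclidean_norm -sqrtr_sqr -sqrtrM ?sqr_ge0//; congr Num.sqrt.
by rewrite mulr_sumr; apply: eq_bigr => i _; rewrite mxE exprMn.
Qed.

Lemma measurable_euclidean_norm d (T : measurableType d) (D : set T)
    (g : T -> 'rV[R]_n) :
  (forall i, measurable_fun D (fun x => g x ord0 i)) ->
  measurable_fun D (fun x => euclidean_norm (g x)).
Proof.
move=> mg; apply: (@measurableT_comp _ _ _ _ _ _ (@Num.sqrt R) _
  (fun x => \sum_i g x ord0 i ^+ 2)).
  by apply: continuous_measurable_fun; exact: sqrt_continuous.
by apply: measurable_sum => i; exact: measurable_funX.
Qed.

End euclidean_norm.

(** * Poincare inequality and scaling in the Sobolev space *)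

Section sobolev_space.
Variables (R : realType) (n : nat) (Omega : set 'rV[R]_n.+1) (p : R).
Hypotheses (oO : open Omega) (bO : bounded_set Omega) (p1 : 1 < p).
Local Open Scope ereal_scope.
Local Notation mu := (lebesgue_rV n.+1).

Let mO : measurable Omega. Proof. exact: open_measurable_rV. Qed.
Let p0 : (0 < p)%R. Proof. exact: lt_trans p1. Qed.
Let pN0 : (p != 0)%R. Proof. by rewrite gt_eqF. Qed.

(** Tonelli along the i-th axis reduces this to poincare_line. *)
Lemma poincare_test phi (i : 'I_n.+1) (M : R) : (0 < M)%R ->
  (forall x i, Omega x -> `|x ord0 i| < M)%R -> test_function Omega phi ->
  Lp_norm Omega p phi <= (M + M)%:E * Lp_norm Omega p (partial i phi).
Proof.
move=> M0 OM tphi; have tdphi := test_function_partial i tphi.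
have MM : (- M < M)%R by rewrite (lt_trans _ M0)// oppr_lt0.
rewrite !Lp_normE//.
have mpow psi : test_function Omega psi ->
    measurable_fun setT (fun x => (`|psi x| `^ p)%:E).
  by move=> tpsi; apply: measurable_norm_powR; exact: test_function_measurable tpsi.
have axisE psi : test_function Omega psi ->
    \int[mu]_(x in Omega) (`|psi x| `^ p)%:E =
    \int[lebesgue_rV n]_y \int[@lebesgue_R R]_(t in `[(- M)%R, M]%classic)
      (`|psi (rV_insert i t y)| `^ p)%:E.
  move=> tpsi; rewrite integral_supported; last first.
    move=> x; apply: contra_neqP => xO; apply/eqP; rewrite eqe powR_eq0 pN0 andbT.
    by rewrite normr_eq0; apply/negPn/negP => /(test_function_supp tpsi).
  rewrite (tonelli_axis i)//; last exact: mpow.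
  apply: eq_integral => y _; rewrite [RHS]integral_supported//.
  move=> t; rewrite eqe powR_eq0 pN0 andbT normr_eq0.
  by move=> /(test_function_line_supp OM tpsi)/andP[? ?]; rewrite /= in_itv/= !ltW.
have I0 : 0 <= \int[mu]_(x in Omega) (`|partial i phi x| `^ p)%:E.
  by apply: integral_ge0.
suff : \int[mu]_(x in Omega) (`|phi x| `^ p)%:E <=
    ((M + M) `^ p)%:E * \int[mu]_(x in Omega) (`|partial i phi x| `^ p)%:E.
  have -> : (M + M)%:E = ((M + M) `^ p)%:E `^ p^-1.
    by rewrite poweR_EFin -powRrM mulfV// powRr1// addr_ge0 ?ltW.
  rewrite -poweRM ?lee_fin ?powR_ge0//; apply: gt0_ler_poweR.
  - by rewrite invr_ge0 ltW.
  - by rewrite in_itv/= leey andbT integral_ge0.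
  - by rewrite in_itv/= leey andbT mule_ge0 ?lee_fin ?powR_ge0.
rewrite !axisE//.
have mline psi : test_function Omega psi -> measurable_fun setT
    (fun y => \int[@lebesgue_R R]_(t in `[(- M)%R, M]%classic)
      (`|psi (rV_insert i t y)| `^ p)%:E).
  move=> tpsi; pose F x := (`|psi x| `^ p)%:E.
  have -> : (fun y => \int[@lebesgue_R R]_(t in `[(- M)%R, M]%classic)
      (`|psi (rV_insert i t y)| `^ p)%:E) =
      (fun y => \int[@lebesgue_R R]_t F (rV_insert i t y)).
    apply/funext => y; apply: integral_supported => t.
    rewrite eqe powR_eq0 pN0 andbT normr_eq0.
    by move=> /(test_function_line_supp OM tpsi)/andP[? ?]; rewrite /= in_itv/= !ltW.
  apply: measurable_line_integral => [|x]; first exact: (mpow _ tpsi).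
  by rewrite /F lee_fin powR_ge0.
rewrite -ge0_integralZl//; last 3 first.
- exact: (mline _ tdphi).
- by move=> y _; exact: integral_ge0.
- by rewrite lee_fin powR_ge0.
apply: ge0_le_integral => //.
- by move=> y _; exact: integral_ge0.
- exact: mline.
- by apply: measurable_funeM; exact: mline.
- move=> y _; have := @poincare_line _ _ _ (fun t => @test_function_line _ _ _ i y _ t tphi)
    (@test_function_line_continuous _ _ _ i y _ tdphi) (- M)%R M p MM p1.
  rewrite opprK; apply.
  apply/eqP; apply: contraT => /(test_function_line_supp OM tphi).
  by rewrite ltxx.
Qed.

Lemma test_function_in_W01p phi : test_function Omega phi ->
  in_W01p Omega p phi (fun x => \row_i partial i phi x)%R.
Proof.
move=> tphi; split; first split.
- exact: test_function_in_Lp.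
- move=> i; under [X in in_Lp _ _ X]eq_fun do rewrite mxE.
  by apply: test_function_in_Lp => //; exact: test_function_partial.
- exact: test_function_weak_gradient.
have N0 : Lp_norm Omega p (cst 0%R) = 0.
  rewrite Lp_normE// (eq_integral (cst 0)) ?integral0 ?poweR0r ?invr_eq0//.
  by move=> x _; rewrite normr0 powR0.
exists (fun=> phi); split => //.
- under eq_fun do (under [X in Lp_norm _ _ X]eq_fun do rewrite subrr).
  by rewrite N0; exact: cvg_cst.
- move=> i; under eq_fun do (under [X in Lp_norm _ _ X]eq_fun do rewrite mxE subrr).
  by rewrite N0; exact: cvg_cst.
Qed.

(** The inequality for the approximating test functions passes to the limit by
    the triangle inequality. *)
Lemma poincare_W01p v g (i : 'I_n.+1) (M : R) : (0 < M)%R ->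
  (forall x i, Omega x -> `|x ord0 i| < M)%R -> in_W01p Omega p v g ->
  Lp_norm Omega p v <= (M + M)%:E * Lp_norm Omega p (fun x => g x ord0 i).
Proof.
move=> M0 OM [[Lv Lg _] [phi [tphi phiv phig]]].
have [mv _] := Lv; have [mg fg] := Lg i.
set G := Lp_norm Omega p (fun x => g x ord0 i).
have G0 : 0 <= G by exact: Lp_norm_ge0.
have Gfin : G \is a fin_num by rewrite ge0_fin_numE.
have MM0 : (0 <= M + M)%R by rewrite addr_ge0 ?ltW.
pose a k := Lp_norm Omega p (fun x => phi k x - v x)%R.
pose b k := Lp_norm Omega p (fun x => partial i (phi k) x - g x ord0 i)%R.
have mphi k : measurable_fun Omega (phi k).
  exact: (measurable_funTS (test_function_measurable (tphi k))).
have mdphi k : measurable_fun Omega (partial i (phi k)).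
  exact: (measurable_funTS (test_function_measurable (test_function_partial i (tphi k)))).
have key k : Lp_norm Omega p v <= a k + (M + M)%:E * (b k + G).
  have -> : Lp_norm Omega p v = Lp_norm Omega p
      (fun x => (- 1) * (phi k x - v x) + phi k x)%R.
    by congr Lp_norm; apply/funext => x; ring.
  apply: le_trans.
    apply: Lp_normD => //.
    by apply: measurable_funM => //; exact: measurable_funB.
  rewrite Lp_normZ//; last exact: measurable_funB.
  rewrite normrN1 mul1e leeD2l//.
  apply: (le_trans (poincare_test i M0 OM (tphi k))).
  rewrite lee_wpmul2l ?lee_fin//.
  have -> : Lp_norm Omega p (partial i (phi k)) = Lp_norm Omega p
      (fun x => (partial i (phi k) x - g x ord0 i) + g x ord0 i)%R.
    by congr Lp_norm; apply/funext => x; ring.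
  by apply: Lp_normD => //; exact: measurable_funB.
(* the terms with a and b tend to 0 *)
rewrite -[leRHS]add0e -[X in (_ * X)]add0e.
suff H : (a k + (M + M)%:E * (b k + G)) @[k --> \oo] --> 0 + (M + M)%:E * (0 + G).
  by apply: cvge_ge H; apply: nearW => k; exact: key.
apply: cvgeD.
- by rewrite add0e ge0_adde_def// inE// mule_ge0// lee_fin.
- exact: phiv.
- apply: cvgeZl => //; apply: cvgeD; [|exact: phig|exact: cvg_cst].
  by rewrite ge0_adde_def// inE.
Qed.

Lemma in_W01pZ (c : R) v g : in_W01p Omega p v g ->
  in_W01p Omega p (fun x => c * v x)%R (fun x => c *: g x)%R.
Proof.
move=> [[Lv Lg wg] [phi [tphi phiv phig]]].
have [mv _] := Lv.
have mphi k := measurable_funTS (D := Omega) (test_function_measurable (tphi k)).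
have cg i : (fun x => (c *: g x)%R ord0 i) = (fun x => c * g x ord0 i)%R.
  by apply/funext => x; rewrite mxE.
split; first split.
- exact: in_LpZ.
- by move=> i; rewrite cg; exact: in_LpZ.
- move=> i psi tpsi.
  have -> : (\int[mu]_(x in Omega) (c * v x * partial i psi x) =
      c * \int[mu]_(x in Omega) (v x * partial i psi x))%R.
    rewrite -RintegralZl//; last first.
      exact: (in_Lp_test_integrable oO bO p1 Lv (test_function_partial i tpsi)).
    by apply: eq_Rintegral => x _; rewrite mulrA.
  rewrite wg// mulrN; congr (- _)%R.
  rewrite -RintegralZl//; last first.
    exact: (in_Lp_test_integrable oO bO p1 (Lg i) tpsi).
  by apply: eq_Rintegral => x _; rewrite mxE mulrA.
exists (fun k x => c * phi k x)%R; split.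
- by move=> k; exact: test_functionZ.
- have -> : (fun k => Lp_norm Omega p (fun x => c * phi k x - c * v x)%R) =
      (fun k => `|c|%:E * Lp_norm Omega p (fun x => phi k x - v x)%R).
    apply/funext => k; rewrite -Lp_normZ//; last exact: measurable_funB.
    by congr Lp_norm; apply/funext => x; rewrite mulrBr.
  by rewrite -(mule0 `|c|%:E); apply: cvgeZl.
- move=> i; have [mg _] := Lg i.
  have -> : (fun k => Lp_norm Omega p
        (fun x => partial i (fun x => c * phi k x) x - (c *: g x) ord0 i)%R) =
      (fun k => `|c|%:E * Lp_norm Omega p (fun x => partial i (phi k) x - g x ord0 i)%R).
    apply/funext => k; have [sphi _ _] := tphi k.
    have mdphi := measurable_funTS (D := Omega) (test_function_measurable
      (test_function_partial i (tphi k))).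
    rewrite -Lp_normZ//; last exact: measurable_funB.
    congr Lp_norm; apply/funext => x.
    rewrite partialM; [|exact: derivable_cst|exact: smooth_derivable].
    by rewrite /partial derive_cst mulr0 addr0 mxE mulrBr.
  by rewrite -(mule0 `|c|%:E); apply: cvgeZl.
Qed.

(** Normalising v by a scalar makes the constraint hold. *)
Lemma lambda_le_quotient (q J : R) v g : (0 < q)%R -> (0 < J)%R ->
  in_W01p Omega p v g -> \int[mu]_(x in Omega) (`|v x| `^ q)%:E = J%:E ->
  lambda Omega p q <=
    (J `^ (- (p / q)))%:E * Lp_norm Omega p (fun x => euclidean_norm (g x)) `^ p.
Proof.
move=> q0 J0 Wvg vJ; pose c := (J `^ (- q^-1))%R.
have [[[mv _] Lg _] _] := Wvg.
have mg i : measurable_fun Omega (fun x => g x ord0 i) by case: (Lg i).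
have c0 : (0 < c)%R by rewrite powR_gt0.
apply: ereal_inf_lbound; exists (fun x => c * v x)%R, (fun x => c *: g x)%R; split.
- exact: in_W01pZ.
- transitivity ((c `^ q)%:E * \int[mu]_(x in Omega) (`|v x| `^ q)%:E).
    rewrite -ge0_integralZl//.
    - by apply: eq_integral => x _; rewrite normrM powRM// (gtr0_norm c0).
    - exact: measurable_norm_powR.
    - by rewrite lee_fin powR_ge0.
  rewrite vJ /c -powRrM mulNr mulVf ?gt_eqF// powR_inv1 ?ltW// -EFinM.
  by rewrite mulVf ?gt_eqF.
- have -> : (fun x => euclidean_norm (c *: g x)) = (fun x => c * euclidean_norm (g x))%R.
    by apply/funext => x; rewrite euclidean_normZ (gtr0_norm c0).
  rewrite Lp_normZ//; last exact: measurable_euclidean_norm.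
  rewrite poweRM ?Lp_norm_ge0// (gtr0_norm c0) poweR_EFin /c -powRrM.
  by rewrite mulNr mulrC.
Qed.

End sobolev_space.

(** * Monotonicity and lower bound *)

Section lambda_quotient.
Variables (R : realType) (n : nat) (Omega : set 'rV[R]_n.+1) (p : R).
Hypotheses (oO : open Omega) (bO : bounded_set Omega) (p1 : 1 < p).
Local Open Scope ereal_scope.
Local Notation mu := (lebesgue_rV n.+1).
Variable m : R.
Hypotheses (m0 : (0 < m)%R) (mE : mu Omega = m%:E).

Let mO : measurable Omega. Proof. exact: open_measurable_rV. Qed.
Let p0 : (0 < p)%R. Proof. exact: lt_trans p1. Qed.

(** This is the comparison of the power means of exponents q and s under the
    constraint, raised to the power p / q so as to match the scaling of lambda. *)
Lemma constraint_power_mean (v : 'rV[R]_n.+1 -> R) (q s : R) :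
  measurable_fun Omega v -> (0 < q < s)%R ->
  \int[mu]_(x in Omega) (`|v x| `^ q)%:E = 1 ->
  1 <= (\int[mu]_(x in Omega) (`|v x| `^ s)%:E) `^ (p / s) *
       (m `^ (p / q - p / s))%:E.
Proof.
move=> mv /andP[q0 qs] v1; have s0 := lt_trans q0 qs.
have I0 : 0 <= \int[mu]_(x in Omega) (`|v x| `^ s)%:E by exact: integral_ge0.
have : 1 <= (\int[mu]_(x in Omega) (`|v x| `^ s)%:E) `^ (q / s) *
    (m `^ (1 - q / s))%:E.
  by rewrite -v1 -poweR_EFin -mE; apply: integral_powR_mono => //; rewrite q0.
move=> /(gt0_ler_poweR (r := p / q)); rewrite poweR1r.
rewrite divr_ge0 ?(ltW p0) ?(ltW q0)// !in_itv/= lee_fin ler01 !leey.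
have -> /= : 0 <= (\int[mu]_(x in Omega) (`|v x| `^ s)%:E) `^ (q / s) *
    (m `^ (1 - q / s))%:E by rewrite mule_ge0 ?poweR_ge0 ?lee_fin ?powR_ge0.
move=> /(_ isT isT isT); rewrite poweRM ?poweR_ge0 ?lee_fin ?powR_ge0//.
rewrite -poweRrM poweR_EFin -powRrM.
have -> : (q / s * (p / q) = p / s)%R by field; rewrite !gt_eqF.
by have -> : ((1 - q / s) * (p / q) = p / q - p / s)%R by field; rewrite !gt_eqF.
Qed.

(** A function admissible for q becomes admissible for s after division by its
    s-norm, which constraint_power_mean bounds from below. *)
Lemma lambda_quotient_mono (q s : R) : (0 < q < s)%R -> (s < p)%R ->
  lambda Omega p s * (m `^ (p / s))%:E <= lambda Omega p q * (m `^ (p / q))%:E.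
Proof.
move=> qs sp; have /andP[q0 qs'] := qs; have s0 := lt_trans q0 qs'.
have key : lambda Omega p s * (m `^ (p / s - p / q))%:E <= lambda Omega p q.
  apply: le_ereal_inf_tmp => _ [v [g [Wvg v1 ->]]].
  have [[Lv _ _] _] := Wvg; have [mv _] := Lv.
  have := constraint_power_mean mv qs v1.
  have := @in_Lp_integral_lty _ _ _ _ oO bO p1 v s.
  rewrite s0 sp => /(_ isT Lv).
  have : 0 <= \int[mu]_(x in Omega) (`|v x| `^ s)%:E by exact: integral_ge0.
  case JE : (\int[mu]_(x in Omega) (`|v x| `^ s)%:E) => [J| |]//.
  rewrite lee_fin => J0 _; rewrite poweR_EFin -EFinM lee_fin => Jm.
  have {}J0 : (0 < J)%R.
    rewrite lt_neqAle J0 andbT; apply/eqP => J00; move: Jm.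
    by rewrite -J00 powR0 ?mul0r ?ler10// mulf_neq0 ?gt_eqF// invr_gt0.
  have := lambda_le_quotient oO bO p1 s0 J0 Wvg JE.
  set T := Lp_norm _ _ _ `^ _ => lT.
  have T0 : 0 <= T by exact: poweR_ge0.
  apply: (@le_trans _ _ ((J `^ (- (p / s)))%:E * T * (m `^ (p / s - p / q))%:E)).
    by apply: lee_wpmul2r => //; rewrite lee_fin powR_ge0.
  rewrite muleAC -EFinM -[leRHS]mul1e lee_wpmul2r// lee_fin.
  rewrite -opprB !powRN -invfM invf_le1// mulr_gt0// powR_gt0//.
have -> : (m `^ (p / s) = m `^ (p / s - p / q) * m `^ (p / q))%R.
  by rewrite -powRD ?subrK// (gt_eqF m0) implybT.
by rewrite EFinM muleA lee_wpmul2r// lee_fin powR_ge0.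
Qed.

(** Power means compare the constraint with the norm of order p, and the
    Poincare inequality compares the latter with the gradient. *)
Lemma lambda_quotient_lb : exists2 c : R, (0 < c)%R & forall q, (0 < q < p)%R ->
  c%:E <= lambda Omega p q * (m `^ (p / q))%:E.
Proof.
have [M M0 OM] := bounded_set_box bO.
have MM0 : (0 < M + M)%R by rewrite addr_gt0.
exists (m / (M + M) `^ p)%R; first by rewrite divr_gt0 ?powR_gt0.
move=> q qp; have /andP[q0 qp'] := qp.
have key : ((m `^ (p / q - 1))^-1 / (M + M) `^ p)%:E <= lambda Omega p q.
  apply: le_ereal_inf_tmp => _ [v [g [Wvg v1 ->]]].
  have [[[mv _] Lg _] _] := Wvg.
  have mg i : measurable_fun Omega (fun x => g x ord0 i) by case: (Lg i).
  have := constraint_power_mean mv qp v1.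
  have I0 : 0 <= \int[mu]_(x in Omega) (`|v x| `^ p)%:E by exact: integral_ge0.
  rewrite divff ?gt_eqF// poweRe1// -Lp_norm_powR//.
  set T := Lp_norm _ _ (fun x => euclidean_norm _).
  have vT : Lp_norm Omega p v <= (M + M)%:E * T.
    apply: (le_trans (poincare_W01p oO p1 ord0 M0 OM Wvg)).
    rewrite lee_wpmul2l ?lee_fin ?(ltW MM0)//.
    apply: le_Lp_norm => //; first exact: measurable_euclidean_norm.
    move=> x _; rewrite (ger0_norm (euclidean_norm_ge0 _)).
    exact: le_euclidean_norm.
  have T0 : 0 <= T by exact: Lp_norm_ge0.
  have : Lp_norm Omega p v `^ p <= ((M + M)%:E * T) `^ p.
    apply: gt0_ler_poweR => //; first exact: ltW.
    - by rewrite in_itv/= leey Lp_norm_ge0.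
    - by rewrite in_itv/= leey andbT mule_ge0// lee_fin ltW.
  rewrite poweRM ?lee_fin ?(ltW MM0)// poweR_EFin => h1 h2.
  have C0 : (0 < (M + M) `^ p)%R by rewrite powR_gt0.
  have k0 : (0 < m `^ (p / q - 1))%R by rewrite powR_gt0.
  have : 1 <= ((M + M) `^ p)%:E * T `^ p * (m `^ (p / q - 1))%:E.
    by apply: le_trans h2 _; rewrite lee_wpmul2r// lee_fin ltW.
  have : 0 <= T `^ p by exact: poweR_ge0.
  case: (T `^ p) => [U| |] //; rewrite ?leey//.
  rewrite -!EFinM !lee_fin => U0 h; rewrite ler_pdivrMr// -div1r ler_pdivrMr//.
  by rewrite [(U * _)%R]mulrC.
have mq : (m `^ (p / q) = m `^ (p / q - 1) * m)%R.
  by rewrite -[X in (_ = _ * X)%R](powRr1 (ltW m0)) -powRD ?subrK// (gt_eqF m0) implybT.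
have k0 : (0 < m `^ (p / q - 1))%R by rewrite powR_gt0.
have -> : (m / (M + M) `^ p =
    (m `^ (p / q - 1))^-1 / (M + M) `^ p * m `^ (p / q))%R.
  by rewrite mq; field; rewrite !gt_eqF ?powR_gt0.
by rewrite EFinM lee_wpmul2r// lee_fin powR_ge0.
Qed.

End lambda_quotient.

(** * The profile h(t) = exp(-1/sqrt t) *)

Section profile.
Variable R : realType.
Implicit Types t s g c q d : R.

Local Notation h := (flat (1 : {poly R})).

Lemma flat1E t : 0 < t -> h t = expR (- (Num.sqrt t)^-1).
Proof. by move=> t0; rewrite /flat t0 hornerC mul1r. Qed.

Lemma flat1_le0 t : t <= 0 -> h t = 0.
Proof. by move=> t0; rewrite /flat ltNge t0. Qed.

Lemma flat1_gt0 t : 0 < t -> 0 < h t.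
Proof. by move=> t0; rewrite flat1E// expR_gt0. Qed.

Lemma flat1_ge0 t : 0 <= h t.
Proof. by have [/flat1_gt0/ltW|/flat1_le0->] := ltP 0 t. Qed.

Lemma flat1_le1 t : h t <= 1.
Proof.
have [t0|/flat1_le0->//] := ltP 0 t.
by rewrite flat1E// expR_le1 oppr_le0 invr_ge0.
Qed.

Lemma flat1_mono s t : s <= t -> h s <= h t.
Proof.
move=> st; have [s0|/flat1_le0->] := ltP 0 s; last exact: flat1_ge0.
have t0 := lt_le_trans s0 st.
rewrite !flat1E// ler_expR lerN2 lef_pV2 ?posrE ?sqrtr_gt0//.
exact: ler_wsqrtr.
Qed.

(** With the shift d = q^2 the estimate holds up to s = 0: below s = 3 q^2 the
    right-hand side is at least 1, and above it s - q^2 is comparable to s + q^2. *)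
Lemma flat1_deficit c q s : 0 < c <= 1 -> 0 < q -> 0 < s ->
  1 - (c * h (s - q ^+ 2)) `^ q <= q * (- ln c + 2 * (Num.sqrt (s + q ^+ 2))^-1).
Proof.
move=> /andP[c0 c1] q0 s0; set d := q ^+ 2.
have d0 : 0 < d by rewrite exprn_gt0.
have sd0 : 0 < Num.sqrt (s + d) by rewrite sqrtr_gt0 addr_gt0.
have lc : 0 <= - ln c by rewrite oppr_ge0 ln_le0.
(* for s <= 3 q^2 one has sqrt (s + q^2) <= 2 q, so the right side is at least 1 *)
have [s3|s3] := leP s (3 * d).
  apply: (@le_trans _ _ 1); first by rewrite gerBl powR_ge0.
  apply: (@le_trans _ _ (q * (2 * (Num.sqrt (s + d))^-1))); last first.
    by rewrite ler_pM2l// lerDr.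
  rewrite mulrA ler_pdivlMr// mul1r.
  have -> : q * 2 = Num.sqrt ((q * 2) ^+ 2) by rewrite sqrtr_sqr gtr0_norm ?mulr_gt0.
  by apply: ler_wsqrtr; rewrite exprMn -/d; lra.
have sd : 0 < s - d by lra.
have hs := flat1_gt0 sd.
have ch : 0 < c * h (s - d) by rewrite mulr_gt0.
have -> : (c * h (s - d)) `^ q = expR (q * ln (c * h (s - d))).
  by rewrite /powR gt_eqF.
rewrite lerBlDr -lerBlDl (le_trans _ (expR_ge1Dx _))// lerD2l.
rewrite lnM ?posrE// flat1E// expRK -mulrN ler_pM2l//.
rewrite opprD opprK lerD2l lerN2.
rewrite -[leLHS]mul1r ler_pdivrMr ?sqrtr_gt0// -mulrA mulrC -mulrA ler_pdivlMl//.
rewrite mulr1 -[2]gtr0_norm// -sqrtr_sqr -sqrtrM ?sqr_ge0//.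
  by apply: ler_wsqrtr; lra.
exact: ltW.
Qed.

Lemma sqrt_sub_le s t : 0 <= s <= t -> Num.sqrt t - Num.sqrt s <= Num.sqrt (t - s).
Proof.
move=> /andP[s0 st]; rewrite lerBlDr.
rewrite -(@ler_pXn2r _ 2)// ?nnegrE ?addr_ge0// sqrrD !sqr_sqrtr ?subr_ge0//.
  by rewrite addrAC subrK lerDl mulrn_wge0// mulr_ge0.
exact: le_trans st.
Qed.

(** The bound does not depend on d: the antiderivative is a multiple of the
    square root, and the difference of square roots is at most the square root
    of the difference. *)
Lemma line_inv_sqrt (b : bool) g d u v : 0 < d -> u < v ->
  0 <= (-1) ^+ b * (u - g) -> 0 <= (-1) ^+ b * (v - g) ->
  (\int[lebesgue_measure]_(t in `[u, v])
    ((Num.sqrt ((-1) ^+ b * (t - g) + d))^-1)%:E <= (2 * Num.sqrt (v - u))%:E)%E.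
Proof.
move=> d0 uv ug vg; pose l t := (-1) ^+ b * (t - g) + d.
have l0 t : t \in `[u, v] -> 0 < l t.
  rewrite in_itv/= => /andP[ut tv]; rewrite ltr_wpDl//.
  by case: b ug vg {l} => /=; rewrite ?expr0 ?expr1; lra.
have dl t : is_derive t 1 l ((-1) ^+ b).
  have -> : l = fun t => (-1) ^+ b * t + (d - (-1) ^+ b * g).
    by apply/funext => x; rewrite /l; ring.
  have := is_deriveD (is_deriveZ ((-1) ^+ b : R) (is_derive_id t (1 : R)))
    (is_derive_cst (d - (-1) ^+ b * g : R) t 1).
  by move/is_derive_eq; apply; rewrite addr0 [LHS]mulr1.
have cl : continuous l.
  by move=> t; apply/differentiable_continuous/derivable1_diffP; case: (dl t).
have cs : continuous (fun t => Num.sqrt (l t)).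
  by move=> t; apply: continuous_comp; [exact: cl|exact: sqrt_continuous].
pose F t := 2 * (-1) ^+ b * Num.sqrt (l t).
have dF t : t \in `[u, v] -> is_derive t 1 F (Num.sqrt (l t))^-1.
  move=> /l0 lt0; have ds := is_derive1_sqrt lt0.
  have dc := @is_derive1_comp _ (@Num.sqrt R) l t _ _ ds (dl t).
  have := is_deriveZ (2 * (-1) ^+ b : R) dc.
  move/is_derive_eq; apply; rewrite /GRing.scale/=.
  rewrite invfM; set S := (Num.sqrt _)^-1.
  have -> : 2 * (-1) ^+ b * (2^-1 * S * (-1) ^+ b) = ((-1) ^+ b) ^+ 2 * S :> R by field.
  by rewrite sqrr_sign mul1r.
rewrite (@continuous_FTC2 _ (fun t => (Num.sqrt (l t))^-1) F)//.
- rewrite -EFinB lee_fin /F.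
  have lE t : Num.sqrt (l t) = Num.sqrt ((-1) ^+ b * (t - g) + d) by [].
  rewrite !lE {lE l l0 dl cl cs F dF}.
  case: b ug vg => /=; rewrite ?expr0 ?expr1 => ug vg.
    have := @sqrt_sub_le (-1 * (v - g) + d) (-1 * (u - g) + d) _.
    have -> : -1 * (u - g) + d - (-1 * (v - g) + d) = v - u by ring.
    have -> : 0 <= -1 * (v - g) + d <= -1 * (u - g) + d by apply/andP; split; lra.
    by move=> /(_ isT); lra.
  have := @sqrt_sub_le (1 * (u - g) + d) (1 * (v - g) + d) _.
  have -> : 1 * (v - g) + d - (1 * (u - g) + d) = v - u by ring.
  have -> : 0 <= 1 * (u - g) + d <= 1 * (v - g) + d by apply/andP; split; lra.
  by move=> /(_ isT); lra.
- apply: derivable_within_continuous => t tuv.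
  apply: derivableV; first by rewrite gt_eqF// sqrtr_gt0 l0.
  have ds := is_derive1_sqrt (l0 _ tuv).
  by case: (@is_derive1_comp _ (@Num.sqrt R) l t _ _ ds (dl t)).
- have cF : continuous F by move=> t; apply: cvgMr; exact: cs.
  split.
  + move=> t tuv; case: (dF t) => //.
    exact: subset_itv_oo_cc.
  + by apply: cvg_at_right_filter; exact: cF.
  + by apply: cvg_at_left_filter; exact: cF.
- move=> t tuv; rewrite derive1E; case: (dF t) => //.
  exact: subset_itv_oo_cc.
Qed.

End profile.

(** * Bumps and pieces over a graph *)

Section bump.
Variables (R : realType) (N : nat).
Implicit Types (a x : 'rV[R]_N) (s d : R) (Omega U : set 'rV[R]_N).
Local Notation h := (flat (1 : {poly R})).

Definition box a s : set 'rV[R]_N :=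
  [set x | forall j, `|x ord0 j - a ord0 j| < s].

(** A smooth function that is positive exactly on the open cube of centre a and
    half-side s. *)
Definition bump a s x : R :=
  \prod_(j < N) (h (s - (x ord0 j - a ord0 j)) * h (s + (x ord0 j - a ord0 j))).

Lemma box_ball a s : 0 < s -> box a s = ball a s.
Proof.
move=> s0; apply/seteqP; split => [x xb|x [_ xb] j].
  by split => // i j; rewrite (ord1 i) /ball/= distrC; exact: xb.
by have := xb ord0 j; rewrite /ball/= distrC.
Qed.

Lemma smooth_affine_coord (e : R) (c : R) j :
  smooth (fun x : 'rV[R]_N => c + e * x ord0 j).
Proof.
move=> k; apply: (@CkD _ _ _ (cst c)); first exact: Ck_cst.
by apply: (@CkM _ _ _ (cst e)); [exact: Ck_cst|exact: Ck_coord].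
Qed.

Lemma smooth_bump a s : smooth (bump a s).
Proof.
move=> k; apply: (@Ck_prod _ _ _ _ (fun j x =>
  h (s - (x ord0 j - a ord0 j)) * h (s + (x ord0 j - a ord0 j)))) => j.
apply: CkM.
  have -> : (fun x : 'rV[R]_N => h (s - (x ord0 j - a ord0 j))) =
      (fun x => h ((s + a ord0 j) + -1 * x ord0 j)).
    by apply/funext => x; congr flat; ring.
  by apply: Ck_flat; exact: smooth_affine_coord.
have -> : (fun x : 'rV[R]_N => h (s + (x ord0 j - a ord0 j))) =
    (fun x => h ((s - a ord0 j) + 1 * x ord0 j)).
  by apply/funext => x; congr flat; ring.
by apply: Ck_flat; exact: smooth_affine_coord.
Qed.

Lemma bump_ge0 a s x : 0 <= bump a s x.
Proof. by apply: prodr_ge0 => j _; rewrite mulr_ge0 ?flat1_ge0. Qed.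

Lemma bump_supp a s x : bump a s x != 0 -> box a s x.
Proof.
move=> /prodf_neq0 bx j; have := bx j isT; rewrite mulf_eq0 negb_or => /andP[h1 h2].
rewrite ltr_norml; apply/andP; split.
  rewrite ltrNl ltNge; apply: contra h2 => le2; apply/eqP/flat1_le0.
  by lra.
by rewrite ltNge; apply: contra h1 => le2; apply/eqP/flat1_le0; rewrite subr_le0.
Qed.

Lemma bump_lb a s x : box a (s / 2) x -> \prod_(j < N) (h (s / 2) * h (s / 2)) <= bump a s x.
Proof.
move=> xb; apply: ler_prod => j _; have := xb j; rewrite ltr_norml => /andP[h1 h2].
rewrite mulr_ge0 ?flat1_ge0//=.
by apply: ler_pM; rewrite ?flat1_ge0//; apply: flat1_mono; lra.
Qed.

Lemma bump_lb_range s : 0 < s ->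
  0 < \prod_(j < N) (h (s / 2) * h (s / 2)) <= 1.
Proof.
move=> s0; have h0 : 0 < h (s / 2) by rewrite flat1_gt0// divr_gt0.
apply/andP; split; first by apply: prodr_gt0 => j _; rewrite mulr_gt0.
suff /andP[] : 0 <= \prod_(j < N) (h (s / 2) * h (s / 2)) <= 1 by [].
elim/big_ind : _ => [|x y /andP[x0 x1] /andP[y0 y1]|j _].
- by rewrite ler01 lexx.
- by rewrite mulr_ge0//= mulr_ile1.
- by rewrite mulr_ge0 ?flat1_ge0//= mulr_ile1 ?flat1_le1 ?flat1_ge0.
Qed.

Lemma compact_closed_box a s :
  compact [set x : 'rV[R]_N | forall j, a ord0 j - s <= x ord0 j <= a ord0 j + s].
Proof.
have := @rV_compact R N (fun j => `[a ord0 j - s, a ord0 j + s]%classic)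
  (fun j => @segment_compact _ _ _).
by congr compact; apply/seteqP; split => x xb j; have := xb j; rewrite /= in_itv.
Qed.

Lemma box_closed_box a s x : box a s x ->
  forall j, a ord0 j - s <= x ord0 j <= a ord0 j + s.
Proof. by move=> xb j; have := xb j; rewrite ltr_norml; lra. Qed.

Lemma bump_test a s : test_function setT (bump a s).
Proof.
apply: (@test_function_in _ _ _ [set x | forall j, a ord0 j - s <= x ord0 j <= a ord0 j + s]).
- exact: smooth_bump.
- exact: compact_closed_box.
- exact: subsetT.
- by move=> x /bump_supp/box_closed_box.
Qed.

End bump.

Section graph.
Variables (R : realType) (N : nat) (i : 'I_N) (b : bool) (gamma : 'rV[R]_N.-1 -> R).
Hypothesis sgamma : smooth gamma.
Local Notation h := (flat (1 : {poly R})).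

(** In a boundary chart the domain is, locally, the set of positive height. *)
Definition height (x : 'rV[R]_N) : R := (-1) ^+ b * (x ord0 i - gamma (col' i x)).

Lemma smooth_height : smooth height.
Proof.
move=> k; have -> : height = fun x => (0 + (-1) ^+ b * x ord0 i) +
    (- (-1) ^+ b) * gamma (col' i x).
  by apply/funext => x; rewrite /height; ring.
apply: CkD; first exact: smooth_affine_coord.
by apply: (@CkM _ _ _ (cst (- (-1) ^+ b))); [exact: Ck_cst|exact: Ck_col'].
Qed.

Variables (a : 'rV[R]_N) (s : R).

(** Shifting the height by d pushes the support of the piece away from the
    graph; the gradient stays bounded because that of flat is. *)
Definition piece (d : R) (x : 'rV[R]_N) : R := bump a s x * h (height x - d).

Lemma smooth_flat_height d : smooth (fun x => h (height x - d)).
Proof.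
move=> k; apply: Ck_flat; apply: (@CkD _ _ _ _ (cst (- d))).
  exact: smooth_height.
exact: Ck_cst.
Qed.

Lemma piece_ge0 d x : 0 <= piece d x.
Proof. by rewrite mulr_ge0 ?bump_ge0 ?flat1_ge0. Qed.

(** The support lies in the closed cube of half-side s, where the chart is
    valid, and at height at least d. *)
Lemma piece_test (Omega : set 'rV[R]_N) (r d : R) : s < r -> 0 < d ->
  (forall x, box a r x -> Omega x <-> 0 < height x) ->
  test_function Omega (piece d).
Proof.
move=> sr d0 chart.
pose C := [set x : 'rV[R]_N | forall j, a ord0 j - s <= x ord0 j <= a ord0 j + s] `&`
  [set x | d <= height x].
apply: (@test_function_in _ _ _ C).
- move=> k; apply: CkM; first exact: smooth_bump.
  exact: smooth_flat_height.
- apply: compact_closedI; first exact: compact_closed_box.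
  have cd : closed [set y : R | d <= y] by exact: closed_ge.
  exact: (iffLR (continuous_closedP height) (smooth_continuous smooth_height) _ cd).
- move=> x [/= xb xd]; apply/chart; last exact: lt_le_trans xd.
  by move=> j; have := xb j; rewrite ltr_norml; lra.
- move=> x; rewrite mulf_eq0 negb_or => /andP[/bump_supp xb hx]; split => /=.
    exact: box_closed_box.
  by rewrite leNgt; apply: contra hx => xd; apply/eqP/flat1_le0; lra.
Qed.

(** The shift d only enters through the values of flat functions, which are
    bounded on the whole line. *)
Lemma piece_partial_bounded : exists K : R, forall d j x,
  `|partial j (piece d) x| <= K.
Proof.
have [H H0 hH] := flat_bounded (flat_deriv (1 : {poly R})).
have /choice[K1 HK1] : forall j : 'I_N, exists K : R, 0 <= K /\
    forall x, `|bump a s x * partial j height x| <= K.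
  move=> j; have [K K0 HK] := test_function_bounded (test_functionM (bump_test a s)
    (smooth_partial j smooth_height)).
  by exists K.
have /choice[K2 HK2] : forall j : 'I_N, exists K : R, 0 <= K /\
    forall x, `|partial j (bump a s) x| <= K.
  move=> j; have [K K0 HK] := test_function_bounded (test_function_partial j (bump_test a s)).
  by exists K.
exists (\sum_j (H * K1 j + K2 j)) => d j x.
have dh : is_derive x (delta_mx ord0 j) (fun x => h (height x - d))
    (flat (flat_deriv 1) (height x - d) * partial j height x).
  have hd : is_derive x (delta_mx ord0 j) (fun x => height x - d) (partial j height x).
    have := is_deriveB (derivableP (@smooth_derivable _ _ _ j x smooth_height))
      (is_derive_cst d x (delta_mx ord0 j)).
    by move/is_derive_eq; apply; rewrite subr0.
  by apply: (@is_derive_chain _ _ h (fun x => height x - d)); first exact: is_derive_flat.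
have -> : partial j (piece d) x =
    flat (flat_deriv 1) (height x - d) * (bump a s x * partial j height x) +
    h (height x - d) * partial j (bump a s) x.
  rewrite /piece partialM; last 2 first.
  - by apply: smooth_derivable; exact: smooth_bump.
  - by case: dh.
  by rewrite [partial j (fun _ => _) x](derive_val (is_derive := dh)); ring.
have [K10 HK1j] := HK1 j; have [K20 HK2j] := HK2 j.
apply: (@le_trans _ _ (H * K1 j + K2 j)).
  apply: (le_trans (ler_normD _ _)); apply: lerD; rewrite normrM.
    exact: ler_pM.
  rewrite -[leRHS]mul1r; apply: ler_pM => //.
  by rewrite ger0_norm ?flat1_ge0// flat1_le1.
rewrite (bigD1 j)//= lerDl; apply: sumr_ge0 => k _.
have [? _] := HK1 k; have [? _] := HK2 k.
by rewrite addr_ge0// mulr_ge0.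
Qed.

End graph.

(** * The deficit of a piece is O(q) *)

Section deficit.
Variables (R : realType) (n : nat).
Local Open Scope ereal_scope.
Local Notation mu := (lebesgue_rV n.+1).

(** Truncation at 0 makes this subadditive in the pair (U, w) for w >= 0. *)
Definition deficit (U : set 'rV[R]_n.+1) (q : R) (w : 'rV[R]_n.+1 -> R) x : R :=
  (Num.max 0 (1 - w x `^ q) * \1_U x)%R.

Lemma deficit_ge0 U q w x : (0 <= deficit U q w x)%R.
Proof. by rewrite mulr_ge0// le_max lexx. Qed.

Lemma deficit_le U q w x : U x -> (1 <= w x `^ q + deficit U q w x)%R.
Proof.
move=> Ux; rewrite /deficit indicE mem_set// mulr1 -lerBlDl.
by rewrite le_max lexx orbT.
Qed.

Lemma measurable_deficit U q w : open U -> continuous w ->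
  measurable_fun setT (deficit U q w).
Proof.
move=> oU cw; apply: measurable_funM; last first.
  by apply: measurable_indic; exact: open_measurable_rV.
apply: measurable_maxr => //; apply: measurable_funB => //.
apply: (measurableT_comp (f := @powR R ^~ q)) => //.
exact: continuous_measurable_rV.
Qed.

Lemma open_box (a : 'rV[R]_n.+1) (s : R) : (0 < s)%R -> open (box a s).
Proof. by move=> s0; rewrite box_ball//; exact: ball_open. Qed.

Variables (Omega : set 'rV[R]_n.+1) (i : 'I_n.+1) (b : bool).
Variables (gamma : 'rV[R]_n -> R) (a : 'rV[R]_n.+1) (r s : R).
Hypotheses (oO : open Omega) (sgamma : smooth gamma) (s0 : (0 < s)%R) (sr : (s < r)%R).
Local Notation height := (@height R n.+1 i b gamma).
Local Notation piece := (@piece R n.+1 i b gamma a s).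
Hypothesis chart : forall x, box a r x -> Omega x <-> (0 < height x)%R.

Let mO : measurable Omega. Proof. exact: open_measurable_rV. Qed.
Let sr2 : (s / 2 < r)%R.
Proof. by apply: lt_trans sr; rewrite gtr_pMr// invf_lt1// ltr1n. Qed.
Let U := box a (s / 2).
Let l : R := (- ln (\prod_(j < n.+1) (flat 1 (s / 2) * flat 1 (s / 2))))%R.
Let l0 : (0 <= l)%R.
Proof. by rewrite oppr_ge0 ln_le0//; case/andP: (bump_lb_range n.+1 s0). Qed.

Lemma piece_deficit_pointwise q x : (0 < q)%R -> Omega x ->
  (deficit U q (piece (q ^+ 2)) x <=
    q * (l + 2 * (Num.sqrt (height x + q ^+ 2))^-1))%R.
Proof.
move=> q0 Ox; rewrite /deficit indicE; have [xU|xU] := boolP (x \in U); last first.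
  by rewrite mulr0 mulr_ge0 ?(ltW q0)// addr_ge0// mulr_ge0.
rewrite mulr1 ge_max; apply/andP; split.
  by rewrite mulr_ge0 ?(ltW q0)// addr_ge0// mulr_ge0.
move/set_mem : xU => xU.
have hx : (0 < height x)%R.
  apply/chart => // j; exact: lt_trans (xU j) sr2.
apply: le_trans (flat1_deficit (bump_lb_range n.+1 s0) q0 hx).
rewrite lerD2l lerN2 ge0_ler_powR ?nnegrE ?(ltW q0)//.
- rewrite mulr_ge0 ?flat1_ge0//.
  by have /andP[/ltW] := bump_lb_range n.+1 s0.
- exact: piece_ge0.
- by rewrite ler_wpM2r ?flat1_ge0// bump_lb.
Qed.

Let B : R := (l * s + 4 * Num.sqrt s)%R.
Let F (q : R) := (fun x => (deficit U q (piece (q ^+ 2)) x)%:E) \_ Omega.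

Let F_ge0 q x : 0 <= F q x.
Proof. by rewrite /F patchE; case: ifP => // _; rewrite lee_fin deficit_ge0. Qed.

Let mF q : measurable_fun setT (F q).
Proof.
have mD : measurable_fun setT (fun x => (deficit U q (piece (q ^+ 2)) x)%:E); last first.
  exact: (measurable_restrictT _ mO).1 (measurable_funTS mD).
apply/measurable_EFinP.
apply: measurable_deficit; first by apply: open_box; rewrite divr_gt0.
apply: smooth_continuous => k; apply: CkM; first exact: smooth_bump.
exact: smooth_flat_height.
Qed.

Let F_neq0 q x : (0 < q)%R -> F q x != 0 -> [/\ Omega x, U x & (0 < height x)%R].
Proof.
move=> q0; rewrite /F patchE; case: ifPn => [/set_mem Ox|]; last by rewrite eqxx.
rewrite eqe /deficit mulf_eq0 negb_or indicE => /andP[_].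
have [/set_mem xU _|] := boolP (x \in U); last by rewrite eqxx.
split => //; apply/chart => // j; exact: lt_trans (xU j) sr2.
Qed.

(** The line through y meets the region in an interval on which the height is
    affine of slope 1 or -1; the power -1/2 of the height is integrable up to
    the graph, which gives a bound uniform in q. *)
Let line_deficit q y : (0 < q)%R ->
  \int[@lebesgue_R R]_t F q (rV_insert i t y) <=
  (q * B)%:E * (\1_(box (col' i a) (s / 2)) y)%:E.
Proof.
move=> q0; have q20 : (0 < q ^+ 2)%R by rewrite exprn_gt0.
have B0 : (0 <= B)%R by rewrite addr_ge0// mulr_ge0// ltW.
rewrite indicE; have [yb|yb] := boolP (y \in box (col' i a) (s / 2)); last first.
  rewrite mule0 integral0_eq// => t _; apply/eqP; apply: contraT => /(F_neq0 q0)[_ xU _].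
  case/negP: yb; apply/mem_set => j; rewrite mxE.
  by have := xU (lift i j); rewrite rV_insert_lift.
rewrite mule1.
pose g := gamma y.
have hE t : height (rV_insert i t y) = ((-1) ^+ b * (t - g))%R.
  by rewrite /height rV_insert_id col'_rV_insert.
(* ]u, v[ is the part of the line inside the cube and at positive height *)
pose u := (if b then a ord0 i - s / 2 else Num.max (a ord0 i - s / 2) g)%R.
pose v := (if b then Num.min (a ord0 i + s / 2) g else a ord0 i + s / 2)%R.
have supp t : F q (rV_insert i t y) != 0 -> (u < t < v)%R.
  move=> /(F_neq0 q0)[_ /(_ i)]; rewrite rV_insert_id ltr_norml hE /u /v.
  case: b {hE u v} => /=; rewrite ?expr0 ?expr1 ?lt_min ?gt_max => h1 h2.
    by apply/and3P; split; lra.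
  by rewrite -andbA; apply/and3P; split; lra.
have [uv|vu] := ltP u v; last first.
  rewrite integral0_eq ?lee_fin ?mulr_ge0 ?(ltW q0)// => t _.
  by apply/eqP; apply: contraT => /supp; lra.
have [ug vg vs] : [/\ 0 <= (-1) ^+ b * (u - g), 0 <= (-1) ^+ b * (v - g) & v - u <= s]%R.
  move: uv; rewrite /u /v; case: b {hE u v supp} => /=; rewrite ?expr0 ?expr1.
    by rewrite lt_min => /andP[h1 h2]; have [h3|h3] := leP (a ord0 i + s / 2)%R g; split; lra.
  by rewrite gt_max => /andP[h1 h2]; have [h3|h3] := leP (a ord0 i - s / 2)%R g; split; lra.
have mline : measurable_fun setT (fun t => F q (rV_insert i t y)).
  exact: (measurableT_comp (@mF q) (measurable_rV_insertl i y)).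
rewrite -(@integral_supported _ _ _ _ `[u, v]%classic); last first.
  by move=> t /supp/andP[? ?]; rewrite /= in_itv/= !ltW.
rewrite integral_lebesgue_R//; last exact: measurable_funTS.
pose G t : R := (q * (l + 2 * (Num.sqrt ((-1) ^+ b * (t - g) + q ^+ 2))^-1))%R.
have den0 t : t \in `[u, v]%R -> (0 <= (-1) ^+ b * (t - g))%R.
  rewrite in_itv/= => /andP[ut tv].
  have [E|E] : ((-1) ^+ b = 1 :> R \/ (-1) ^+ b = -1 :> R)%R.
    by case: (b); rewrite ?expr0 ?expr1; [right|left].
  - by move: ug; rewrite E; lra.
  - by move: vg; rewrite E; lra.
have mS : measurable_fun [set: R] (fun t => (Num.sqrt ((-1) ^+ b * (t - g) + q ^+ 2))^-1)%R.
  have -> : (fun t => (Num.sqrt ((-1) ^+ b * (t - g) + q ^+ 2))^-1)%R =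
      (fun t => (Num.sqrt ((-1) ^+ b * (t - g) + q ^+ 2)) `^ (-1))%R.
    by apply/funext => t; rewrite powR_inv1.
  apply: (measurableT_comp (f := @powR R ^~ (-1)%R)) => //.
  apply: continuous_measurable_fun => t.
  apply: continuous_comp; last exact: sqrt_continuous.
  by apply: cvgD; [apply: cvgMr; apply: cvgB; [exact: cvg_id|exact: cvg_cst]|exact: cvg_cst].
apply: (@le_trans _ _ (\int[lebesgue_measure]_(t in `[u, v]) (G t)%:E)).
  apply: ge0_le_integral => //.
  - exact: measurable_funTS.
  - apply/measurable_EFinP/measurable_funTS; apply: measurable_funM => //.
    by apply: measurable_funD => //; exact: measurable_funM.
  - move=> t tuv; rewrite /F patchE; case: ifPn => [/set_mem Ox|_].
      by rewrite lee_fin /G -hE; exact: piece_deficit_pointwise.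
    by rewrite lee_fin mulr_ge0 ?(ltW q0)// addr_ge0// mulr_ge0.
have iS := line_inv_sqrt q20 uv ug vg.
pose S t : R := ((Num.sqrt ((-1) ^+ b * (t - g) + q ^+ 2))^-1)%R.
have S0 t : (0 <= S t)%R by rewrite invr_ge0.
have mSE D : measurable_fun D (fun t : measurableTypeR R => (S t)%:E).
  by apply/measurable_EFinP; exact: measurable_funTS.
have -> : \int[lebesgue_measure]_(t in `[u, v]) (G t)%:E =
    q%:E * (\int[lebesgue_measure]_(t in `[u, v]) l%:E +
            2%:E * \int[lebesgue_measure]_(t in `[u, v]) (S t)%:E).
  have m2S : measurable_fun `[u, v]%classic (fun t : measurableTypeR R => 2%:E * (S t)%:E).
    by apply: measurable_funeM; exact: mSE.
  have mlS : measurable_fun `[u, v]%classic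
      (fun t : measurableTypeR R => l%:E + 2%:E * (S t)%:E).
    exact: emeasurable_funD.
  have S2 t : 0 <= 2%:E * (S t)%:E by rewrite -EFinM lee_fin mulr_ge0.
  rewrite -[X in _ + X]ge0_integralZl//; last by move=> t _; rewrite lee_fin.
  rewrite -ge0_integralD//.
  rewrite -ge0_integralZl//; last 2 first.
  - by move=> t _; rewrite adde_ge0// lee_fin.
  - by rewrite lee_fin ltW.
rewrite integral_cst//= lebesgue_measure_itv/= lte_fin uv.
rewrite [leRHS]EFinM lee_wpmul2l ?lee_fin ?(ltW q0)// /B [(l * s + _)%:E]EFinD.
apply: leeD.
  by rewrite -EFinB -EFinM lee_fin ler_wpM2l.
apply: (@le_trans _ _ (2%:E * (2 * Num.sqrt (v - u))%:E)).
  by rewrite lee_wpmul2l.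
rewrite -EFinM lee_fin mulrA -natrM ler_wpM2l//.
exact: ler_wsqrtr.
Qed.

(** Integrate the bound on each line parallel to the axis of the chart; only the
    lines through a bounded section of the cube contribute. *)
Lemma piece_deficit : exists L : R, forall q, (0 < q)%R ->
  \int[mu]_(x in Omega) (deficit U q (piece (q ^+ 2)) x)%:E <= (q * L)%:E.
Proof.
have mbox : lebesgue_rV n (box (col' i a) (s / 2)) = (s ^+ n)%:E.
  pose A (j : 'I_n) : set R :=
    `](col' i a ord0 j - s / 2)%R, (col' i a ord0 j + s / 2)%R[%classic.
  have mA j : measurable (A j) by exact: measurable_itv.
  have -> : box (col' i a) (s / 2) = [set y : 'rV[R]_n | forall j, A j (y ord0 j)].
    apply/seteqP; split => y yb j; have := yb j; rewrite /A/= in_itv/= ltr_norml => h;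
      apply/andP; split; lra.
  rewrite lebesgue_rV_box//.
  have -> : \prod_(j < n) lebesgue_measure (A j) = \prod_(j < n) s%:E.
    apply: eq_bigr => j _; rewrite /A lebesgue_measure_itv/= lte_fin.
    have -> : (col' i a ord0 j - s / 2 < col' i a ord0 j + s / 2)%R.
      by rewrite ltrD2l (lt_trans (_ : _ < 0)%R) ?oppr_lt0 ?divr_gt0.
    by rewrite -EFinB; congr EFin; field.
  by rewrite prodEFin prodr_const card_ord.
have mb : measurable (box (col' i a) (s / 2)).
  by rewrite box_ball ?divr_gt0//; apply: open_measurable_rV; exact: ball_open.
exists (B * s ^+ n)%R => q q0.
have B0 : (0 <= B)%R by rewrite addr_ge0// mulr_ge0// ltW.
rewrite integral_mkcond -/(F q) (tonelli_axis i)//.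
apply: (@le_trans _ _ (\int[lebesgue_rV n]_y
    ((q * B)%:E * (\1_(box (col' i a) (s / 2)) y)%:E))).
  apply: ge0_le_integral => //.
  - by move=> y _; exact: integral_ge0.
  - exact: measurable_line_integral.
  - by apply: measurable_funeM; apply/measurable_EFinP; exact: measurable_indic.
  - by move=> y _; exact: line_deficit.
rewrite ge0_integralZl//; last 2 first.
- by apply/measurable_EFinP; exact: measurable_indic.
- by rewrite lee_fin mulr_ge0// ltW.
by rewrite integral_indic// setIT -[X in _ * X]/(lebesgue_rV n _) mbox -EFinM mulrA.
Qed.

End deficit.

(** * Competitors on the whole domain *)

Section competitors.
Variables (R : realType) (n : nat) (Omega : set 'rV[R]_n.+1).
Hypothesis oO : open Omega.
Local Open Scope ereal_scope.
Local Notation mu := (lebesgue_rV n.+1).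

Let mO : measurable Omega. Proof. exact: open_measurable_rV. Qed.

(** The parameter d keeps the support of W d inside Omega. At d = q ^+ 2 this
    costs only O(q) in the mean of the q-th power, which is what keeps the
    quotient bounded as q tends to 0. *)
Definition competitor (U : set 'rV[R]_n.+1) (W : R -> 'rV[R]_n.+1 -> R) (K L : R) :=
  [/\ open U,
      forall d : R, (0 < d)%R -> test_function Omega (W d),
      forall d x, (0 <= W d x)%R,
      forall (d : R) j x, (0 < d)%R -> (`|partial j (W d) x| <= K)%R &
      forall q : R, (0 < q)%R ->
        \int[mu]_(x in Omega) (deficit U q (W (q ^+ 2)) x)%:E <= (q * L)%:E].

Lemma competitor0 : competitor set0 (fun _ => cst 0%R) 0 0.
Proof.
split => //.
- by move=> d _; exact: test_function0.
- by move=> d j x _; rewrite /partial derive_cst normr0.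
- move=> q q0; rewrite mulr0 integral0_eq// => x _.
  by rewrite /deficit indic0 mulr0.
Qed.

(** The sum dominates both terms, so its deficit on the union is at most the sum
    of the deficits. *)
Lemma competitorU U1 W1 K1 L1 U2 W2 K2 L2 :
  competitor U1 W1 K1 L1 -> competitor U2 W2 K2 L2 ->
  competitor (U1 `|` U2) (fun d x => W1 d x + W2 d x)%R (K1 + K2) (L1 + L2).
Proof.
move=> [oU1 tW1 W10 dW1 D1] [oU2 tW2 W20 dW2 D2]; split.
- exact: openU.
- by move=> d d0; apply: test_functionD; [exact: tW1|exact: tW2].
- by move=> d x; rewrite addr_ge0.
- move=> d j x d0; have [s1 _ _] := tW1 _ d0; have [s2 _ _] := tW2 _ d0.
  have -> : partial j (fun x => W1 d x + W2 d x)%R x =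
      (partial j (W1 d) x + partial j (W2 d) x)%R.
    exact: (deriveD (@smooth_derivable _ _ _ j x s1) (@smooth_derivable _ _ _ j x s2)).
  by rewrite (le_trans (ler_normD _ _))// lerD ?dW1 ?dW2.
- move=> q q0; have q20 : (0 < q ^+ 2)%R by rewrite exprn_gt0.
  have mD U w : open U -> test_function Omega w ->
      measurable_fun Omega (fun x => (deficit U q w x)%:E).
    move=> oU [sW _ _]; apply/measurable_EFinP/measurable_funTS.
    by apply: measurable_deficit => //; exact: smooth_continuous.
  rewrite mulrDr EFinD; apply: le_trans (leeD (D1 _ q0) (D2 _ q0)).
  rewrite -ge0_integralD//; last 4 first.
  - by move=> x _; rewrite lee_fin deficit_ge0.
  - by apply: mD => //; exact: tW1.
  - by move=> x _; rewrite lee_fin deficit_ge0.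
  - by apply: mD => //; exact: tW2.
  apply: ge0_le_integral => //.
  - by move=> x _; rewrite lee_fin deficit_ge0.
  - apply: mD; first exact: openU.
    by apply: test_functionD; [exact: tW1|exact: tW2].
  - by apply: emeasurable_funD; apply: mD => //; [exact: tW1|exact: tW2].
  - move=> x _; rewrite -EFinD lee_fin.
    have mono (w : R) : (0 <= w)%R -> (w <= W1 (q ^+ 2) x + W2 (q ^+ 2) x)%R ->
        (Num.max 0 (1 - (W1 (q ^+ 2) x + W2 (q ^+ 2) x) `^ q) <=
         Num.max 0 (1 - w `^ q))%R.
      move=> w0 ww; rewrite ge_max le_max lexx/= le_max; apply/orP; right.
      by rewrite lerD2l lerN2 ge0_ler_powR ?nnegrE ?(ltW q0)// addr_ge0.
    have [xU|xU] := boolP (x \in U1).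
      apply: (@le_trans _ _ (deficit U1 q (W1 (q ^+ 2)) x)%R); last first.
        by rewrite lerDl deficit_ge0.
      rewrite /deficit !indicE in_setU xU/= !mulr1; apply: mono => //.
      by rewrite lerDl.
    have [xU2|xU2] := boolP (x \in U2).
      apply: (@le_trans _ _ (deficit U2 q (W2 (q ^+ 2)) x)%R); last first.
        by rewrite lerDr deficit_ge0.
      rewrite /deficit !indicE in_setU xU2 orbT/= !mulr1; apply: mono => //.
      by rewrite lerDr.
    by rewrite /deficit !indicE in_setU (negbTE xU) (negbTE xU2)/= !mulr0 addr0.
Qed.

Hypothesis sO : smooth_boundary Omega.

(** At an interior point the graph can be a hyperplane that misses the cube. *)
Lemma chart_near a : closure Omega a -> exists r i b (gamma : 'rV[R]_n -> R),
  [/\ (0 < r)%R, smooth gamma & forall x, box a r x ->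
    Omega x <-> (0 < @height R n.+1 i b gamma x)%R].
Proof.
move=> cla; have [Oa|Oa] := pselect (Omega a).
  move: (oO); rewrite openE => /(_ _ Oa)/nbhs_ballP[r /= r0 arO].
  exists r, ord0, false, (cst (a ord0 ord0 - r)%R); split => //.
    by move=> k; exact: Ck_cst.
  move=> x xb; split => [_|_]; last by apply: arO; rewrite -box_ball.
  rewrite /height expr0 mul1r; have := xb ord0.
  by rewrite ltr_norml/=; lra.
have [|i [b [gamma [sg]]]] := @sO a.
  by split => // /interior_subset.
move=> /nbhs_ballP[r /= r0 ar]; exists r, i, b, gamma; split => //.
by move=> x; rewrite box_ball//; exact: ar.
Qed.

Lemma competitor_near a : closure Omega a ->
  exists U, U a /\ exists W K L, competitor U W K L.
Proof.
move=> /chart_near[r [i [b [gamma [r0 sg chart]]]]].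
pose s := (r / 2)%R.
have s0 : (0 < s)%R by rewrite divr_gt0.
have sr : (s < r)%R by rewrite gtr_pMr// invf_lt1// ltr1n.
have s20 : (0 < s / 2)%R by rewrite divr_gt0.
have [K HK] := @piece_partial_bounded R n.+1 i b gamma sg a s.
have [L HL] := @piece_deficit R n Omega i b gamma a r s oO sg s0 sr chart.
exists (box a (s / 2)); split; first by rewrite box_ball//; exact: ballxx.
exists (@piece R n.+1 i b gamma a s), K, L; split => //.
- exact: open_box.
- by move=> d d0; exact: (@piece_test _ _ _ _ _ _ _ _ _ r).
- by move=> d x; exact: piece_ge0.
Qed.

Hypothesis bO : bounded_set Omega.

(** The closure of Omega is compact, and each of its points has a neighbourhood
    carrying a competitor; add finitely many of them. *)
Lemma competitor_exists : exists U W K L, Omega `<=` U /\ competitor U W K L.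
Proof.
have /choice[U HU] : forall a, exists U, closure Omega a ->
    U a /\ exists W K L, competitor U W K L.
  move=> a; have [/competitor_near[U ?]|] := pselect (closure Omega a).
    by exists U.
  by exists set0.
have fin (s : seq 'rV[R]_n.+1) : (forall a, a \in s -> closure Omega a) ->
    exists V W K L, (forall a x, a \in s -> U a x -> V x) /\ competitor V W K L.
  elim: s => [_|a s IHs H].
    by exists set0, (fun _ => cst 0%R), 0%R, 0%R; split => //; exact: competitor0.
  have [|V [W [K [L [HV cV]]]]] := IHs; first by move=> x xs; apply: H; rewrite inE xs orbT.
  have [_ [W' [K' [L' cU]]]] := HU a (H a (mem_head _ _)).
  exists (U a `|` V), (fun d x => W' d x + W d x)%R, (K' + K)%R, (L' + L)%R.
  split; last exact: competitorU.
  by move=> a' x; rewrite inE => /predU1P[->|a's]; [left|right; exact: HV a's _].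
have [M M0 OM] := bounded_set_box bO.
pose C := [set x : 'rV[R]_n.+1 | forall j,
  ((0 : 'rV[R]_n.+1) ord0 j - M <= x ord0 j <= (0 : 'rV[R]_n.+1) ord0 j + M)%R].
have cC : compact C by exact: compact_closed_box.
have clC : closed C by apply: compact_closed => //; exact: norm_hausdorff.
have cO : compact (closure Omega).
  apply: (subclosed_compact _ cC); first exact: closed_closure.
  rewrite [X in _ `<=` X](iffLR (closure_id C) clC); apply: closure_subset => x Ox.
  by apply: box_closed_box => j; rewrite mxE subr0; exact: OM.
move: cO; rewrite compact_cover => /(_ _ (closure Omega) U)[].
- by move=> a /HU[_ [W [K [L []]]]].
- by move=> a cla; exists a => //; case: (HU _ cla).
move=> D DO OD.
have [|V [W [K [L [HV cV]]]]] := fin (finmap.enum_fset D).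
  by move=> a aD; apply/set_mem/DO.
exists V, W, K, L; split => // x /subset_closure/OD[a /= aD Uax].
exact: HV _ _ aD Uax.
Qed.

End competitors.

(** * Upper bound and conclusion *)

Section upper_bound.
Variables (R : realType) (n : nat) (Omega : set 'rV[R]_n.+1) (p : R).
Hypotheses (oO : open Omega) (bO : bounded_set Omega).
Hypotheses (sO : smooth_boundary Omega) (p1 : 1 < p).
Variable m : R.
Hypotheses (m0 : 0 < m) (mE : lebesgue_rV n.+1 Omega = m%:E).
Local Open Scope ereal_scope.
Local Notation mu := (lebesgue_rV n.+1).

Let mO : measurable Omega. Proof. exact: open_measurable_rV. Qed.
Let p0 : (0 < p)%R. Proof. exact: lt_trans p1. Qed.

(** Integrate 1 <= W `^ q + deficit over Omega. *)
Lemma competitor_mass U W K L q : competitor Omega U W K L -> Omega `<=` U ->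
  (0 < q)%R -> m%:E <= \int[mu]_(x in Omega) (`|W (q ^+ 2)%R x| `^ q)%:E + (q * L)%:E.
Proof.
move=> [oU tW W0 _ D] OU q0; have q20 : (0 < q ^+ 2)%R by rewrite exprn_gt0.
have [sW _ _] := tW _ q20.
have mW : measurable_fun Omega (fun x => (`|W (q ^+ 2)%R x| `^ q)%:E).
  apply: measurable_norm_powR; apply: measurable_funTS.
  exact: test_function_measurable (tW _ q20).
have mD : measurable_fun Omega (fun x => (deficit U q (W (q ^+ 2)%R) x)%:E).
  apply/measurable_EFinP/measurable_funTS; apply: measurable_deficit => //.
  exact: smooth_continuous.
apply: le_trans (leeD (lexx _) (D q q0)).
rewrite -ge0_integralD//; last by move=> x _; rewrite lee_fin deficit_ge0.
rewrite -mE -[leLHS]mul1e -integral_cst//; apply: ge0_le_integral => //.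
- exact: emeasurable_funD.
- move=> x Ox; rewrite -EFinD lee_fin ger0_norm//.
  by apply: deficit_le; exact: OU.
Qed.

(** The competitor W at d = q ^+ 2 has mass J >= m (1 - A q), whence
    (J / m) `^ (- (p / q)) <= exp (2 A p) for q <= 1 / (2 A), while its gradient
    is bounded independently of q. *)
Lemma lambda_quotient_ub : exists c q0 : R, (0 < q0)%R /\
  forall q : R, (0 < q < q0)%R -> lambda Omega p q * (m `^ (p / q))%:E <= c%:E.
Proof.
have [U [W [K [L [OU cW]]]]] := competitor_exists oO sO bO.
pose A := ((`|L| + 1) / m)%R.
have A0 : (0 < A)%R by rewrite divr_gt0// ltr_wpDl.
have A20 : (0 < 2 * A)%R by apply: mulr_gt0.
pose K' := (Num.sqrt n.+1%:R * `|K|)%R.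
have K'0 : (0 <= K')%R by rewrite mulr_ge0.
exists (expR (2 * A * p) * (K' `^ p * m))%R, (Num.min p (2 * A)^-1)%R; split.
  by rewrite lt_min p0 invr_gt0.
move=> q /andP[q0]; rewrite lt_min => /andP[qp qA].
have q20 : (0 < q ^+ 2)%R by rewrite exprn_gt0.
have [oU tW W0 dW _] := cW.
have mass := competitor_mass cW OU q0.
have tw := tW _ q20; set w := W (q ^+ 2)%R in tw mass.
have Aq : (2 * (A * q) < 1)%R.
  move: qA; rewrite -[ltRHS]div1r ltr_pdivlMr//.
  by have -> : (q * (2 * A) = 2 * (A * q))%R by ring.
have Lw := test_function_in_Lp oO bO p1 tw.
have := @in_Lp_integral_lty _ _ _ _ oO bO p1 w q; rewrite q0 qp => /(_ isT Lw).
have : 0 <= \int[mu]_(x in Omega) (`|w x| `^ q)%:E by exact: integral_ge0.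
move: mass; case JE : (\int[mu]_(x in Omega) (`|w x| `^ q)%:E) => [J| |]//.
rewrite -EFinD !lee_fin => mass J0 _.
have Jm : (1 - A * q <= J / m)%R.
  rewrite ler_pdivlMr// mulrBl mul1r lerBlDr (le_trans mass)// lerD2l.
  have -> : (A * q * m = q * (`|L| + 1))%R by rewrite /A; field; rewrite gt_eqF.
  by rewrite ler_pM2l// (le_trans (ler_norm L))// lerDl.
(* (1 - a) (1 + 2 a) >= 1 for 0 <= a <= 1/2 *)
have eJ : (expR (- (2 * (A * q))) <= J / m)%R.
  apply: le_trans Jm; rewrite expRN -div1r ler_pdivrMr ?expR_gt0//.
  apply: (@le_trans _ _ ((1 - A * q) * (1 + 2 * (A * q)))%R).
    have -> : ((1 - A * q) * (1 + 2 * (A * q)) = 1 + A * q * (1 - 2 * (A * q)))%R by ring.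
    rewrite lerDl; apply: mulr_ge0; first by apply: mulr_ge0; exact: ltW.
    by rewrite subr_ge0; exact: ltW Aq.
  by rewrite ler_wpM2l ?expR_ge1Dx// subr_ge0; lra.
have Jm0 : (0 < J / m)%R by rewrite (lt_le_trans _ eJ)// expR_gt0.
have {}J0 : (0 < J)%R by move: Jm0; rewrite pmulr_lgt0// invr_gt0.
have := lambda_le_quotient oO bO p1 q0 J0 (test_function_in_W01p oO bO p1 tw) JE.
set T := Lp_norm _ _ _ `^ _ => lT.
have TK : T <= (K' `^ p * m)%:E.
  have mg : measurable_fun Omega (fun x => euclidean_norm (\row_i partial i w x)).
    apply: measurable_euclidean_norm => i; under eq_fun do rewrite mxE.
    exact: measurable_funTS (test_function_measurable (test_function_partial i tw)).
  rewrite /T Lp_norm_powR// EFinM -mE; apply: bounded_integral_powR => // x _.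
  rewrite ger0_norm ?euclidean_norm_ge0//; apply: euclidean_norm_le => // i.
  by rewrite mxE (le_trans (dW _ i x q20))// ler_norm.
have T0 : 0 <= T by exact: poweR_ge0.
apply: (@le_trans _ _ ((J `^ (- (p / q)))%:E * T * (m `^ (p / q))%:E)).
  by rewrite lee_wpmul2r// lee_fin powR_ge0.
rewrite muleAC -EFinM [leRHS]EFinM; apply: lee_pmul => //.
  by rewrite lee_fin mulr_ge0// powR_ge0.
rewrite lee_fin.
have -> : (J `^ (- (p / q)) * m `^ (p / q) = (J / m) `^ (- (p / q)))%R.
  rewrite (powRM _ (ltW J0)) ?invr_ge0 ?(ltW m0)//; congr (_ * _)%R.
  by rewrite -(powR_inv1 (ltW m0)) -powRrM mulN1r opprK.
rewrite /powR gt_eqF// ler_expR.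
have lJ : (- (2 * (A * q)) <= ln (J / m))%R.
  by rewrite -[leLHS]expRK ler_ln ?posrE// expR_gt0.
have -> : (2 * A * p = - (p / q) * (- (2 * (A * q))))%R by field; rewrite gt_eqF.
by rewrite ler_wnM2l// oppr_le0 divr_ge0 ?ltW.
Qed.

End upper_bound.

Theorem mainTheorem1 (R : realType) (N : nat) (p : R) (Omega : set 'rV[R]_N)
    (hN : (2 <= N)%N) (hp : 1 < p) (hOmega : bounded_smooth_domain Omega) :
  exists mu : \bar R,
    (lambda Omega p q * lebesgue_rV N Omega `^ (p / q))%E @[q --> 0^'+] --> mu /\
    (0 < mu < +oo)%E.
Proof.
case: N Omega hN hOmega => [//|n] Omega _ [neO oO _ bO sO].
have p0 : 0 < p := lt_trans ltr01 hp.
have mgt0 := lebesgue_rV_open_gt0 oO neO.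
have mlty := lebesgue_rV_bounded oO bO.
move: mgt0 mlty; case mE : (lebesgue_rV n.+1 Omega) => [m| |] //.
rewrite lte_fin => m0 _.
pose f q := (lambda Omega p q * (m `^ (p / q))%:E)%E.
have fE : (fun q => (lambda Omega p q * m%:E `^ (p / q))%E) = f by [].
rewrite fE; exists (ereal_sup (f @` [set` Interval (BRight 0) (BLeft p)])).
have dec : {in Interval (BRight 0) (BLeft p) &, {homo f : q s / q <= s >-> (s <= q)%E}}.
  move=> q s; rewrite !in_itv/= => /andP[q0 qp] /andP[s0 sp].
  rewrite le_eqVlt => /predU1P[->//|qs].
  by apply: lambda_quotient_mono => //; rewrite q0.
split; first by apply: nonincreasing_at_right_cvge => //; rewrite bnd_simp.
have [c c0 lb] := lambda_quotient_lb oO bO hp m0 mE.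
have [C [q0 [q00 ub]]] := lambda_quotient_ub oO bO sO hp m0 mE.
apply/andP; split.
  have p2 : 0 < p / 2 < p by rewrite divr_gt0//= gtr_pMr// invf_lt1// ltr1n.
  apply: (@lt_le_trans _ _ (f (p / 2))).
    by apply: lt_le_trans (lb _ p2); rewrite lte_fin.
  by apply: ereal_sup_ubound; exists (p / 2) => //=; rewrite in_itv/= p2.
apply: (@le_lt_trans _ _ C%:E); last exact: ltry.
apply: ge_ereal_sup => _ [q /= + <-]; rewrite in_itv/= => /andP[qgt0 qp].
pose s := Num.min q (q0 / 2).
have s0 : 0 < s by rewrite lt_min qgt0 divr_gt0.
apply: (@le_trans _ _ (f s)).
  apply: dec; rewrite ?in_itv/= ?qgt0 ?s0//= ?ge_min ?lexx//.
  by rewrite gt_min qp.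
apply: ub; rewrite s0/= gt_min; apply/orP; right.
by rewrite gtr_pMr// invf_lt1// ltr1n.
Qed.
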